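(* Let $X$ and $Y$ be compact Hausdorff spaces and let $(C(Y),C(X))$ be an abelian $C^*$-inclusion with corresponding continuous surjection $j:Y\to X$. Then the following are equivalent: (i) There exists a unique pseudo-expectation for $(C(Y),C(X))$. (ii) There exists a unique multiplicative pseudo-expectation for $(C(Y),C(X))$. (iii) There exists a unique maximal $C(X)$-disjoint ideal in $C(Y)$. (iv) There exists a unique minimal closed set $K\subseteq Y$ such that $j(K)=X$.
   Context: A $C^*$-inclusion $(\mathcal{C},\mathcal{D})$ is a pair of unital $C^*$-algebras with $\mathcal{D} \subseteq \mathcal{C}$ and having the same unit. Here $C(X)$ is regarded as a unital $C^*$-subalgebra of $C(Y)$ via the unital $*$-monomorphism $f\mapsto f\circ j$, where $j:Y\to X$ is a continuous surjection (every abelian $C^*$-inclusion arises this way). ''ucp'' means unital completely positive. A $C^*$-algebra is injective if it is an injective object in the category of operator systems and ucp maps. $I(\mathcal{D})$ denotes a fixed injective envelope of $\mathcal{D}$: an injective unital $C^*$-algebra containing $\mathcal{D}$ as a unital $C^*$-subalgebra, such that for every injective operator system $\mathcal{S}$ and unital complete isometry $\tau:\mathcal{D}\to\mathcal{S}$ there is a unital complete isometry $\tau_1:I(\mathcal{D})\to\mathcal{S}$ with $\tau_1|_{\mathcal{D}}=\tau$. A pseudo-expectation for $(\mathcal{C},\mathcal{D})$ is a ucp map $\Phi:\mathcal{C}\to I(\mathcal{D})$ with $\Phi|_{\mathcal{D}}=\operatorname{id}$; it is multiplicative if it is a $*$-homomorphism. A closed two-sided ideal $\mathcal{J}$ of $\mathcal{C}$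 is $\mathcal{D}$-disjoint if $\mathcal{D}\cap\mathcal{J}=0$; maximality is with respect to inclusion among $\mathcal{D}$-disjoint ideals. In (iv), minimality is with respect to inclusion among closed sets $K\subseteq Y$ with $j(K)=X$. *)

(* Defs.v *)
From HB Require Import structures.
From mathcomp Require Import all_boot all_order all_algebra.
From mathcomp Require Import all_classical all_reals topology normedtype.
From mathcomp Require Import complex.

Set Implicit Arguments.
Unset Strict Implicit.
Unset Printing Implicit Defensive.

Import Order.TTheory GRing.Theory Num.Theory numFieldNormedType.Exports.

Local Open Scope classical_set_scope.
Local Open Scope ring_scope.
Local Open Scope complex_scope.

(* Unital complex C*-algebras.  The product is a field of the mixin because the
   hierarchy has no join of (possibly zero) rings with normed modules.  The
   case cunit = 0 is allowed, so that C(X) is a C*-algebra also for empty X. *)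
HB.mixin Record isCStarAlgebra (R : realType) A of CompleteNormedModule R[i] A := {
  cunit : A;
  cmul : A -> A -> A;
  star : A -> A;
  cmulA : associative cmul;
  cmul1x : left_id cunit cmul;
  cmulx1 : right_id cunit cmul;
  cmulDl : left_distributive cmul +%R;
  cmulDr : right_distributive cmul +%R;
  cscaleAl : forall (a : R[i]) x y, a *: cmul x y = cmul (a *: x) y;
  cscaleAr : forall (a : R[i]) x y, a *: cmul x y = cmul x (a *: y);
  starK : involutive star;
  starD : {morph star : x y / x + y};
  starZ : forall (a : R[i]) x, star (a *: x) = a^* *: star x;
  starM : forall x y, star (cmul x y) = cmul (star y) (star x);
  cnormM : forall x y, `|cmul x y| <= `|x| * `|y|;
  cstar_identity : forall x, `|cmul (star x) x| = `|x| ^+ 2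
}.

#[short(type="cstarAlgType")]
HB.structure Definition CStarAlgebra (R : realType) :=
  {A of CompleteNormedModule R[i] A & isCStarAlgebra R A}.

Notation "x ** y" := (cmul x y) (at level 40, left associativity) : ring_scope.

Section ComplexComplete.
Variable R : realType.
Implicit Types z w : R[i].

Lemma Re_norm z : (complex.Re `|z|)%:C = `|z|.
Proof. by rewrite normc_def. Qed.

Lemma norm_Re z : `|complex.Re z| <= complex.Re `|z|.
Proof. by have := normc_ge_Re z; rewrite -[X in _ <= X]Re_norm lecR. Qed.

Lemma norm_i : `|'i%C : R[i]| = 1.
Proof. by rewrite normc_def/= expr0n/= add0r expr1n sqrtr1. Qed.

Lemma norm_real (x : R) : `|x%:C| = `|x|%:C.
Proof. by rewrite normc_def/= expr0n/= addr0 sqrtr_sqr. Qed.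

Lemma norm_Im z : `|complex.Im z| <= complex.Re `|z|.
Proof.
by have := norm_Re (z * 'i%C); rewrite ReiNIm normrN normrM norm_i mulr1.
Qed.

Lemma norm_Re_Im z :
  complex.Re `|z| <= `|complex.Re z| + `|complex.Im z|.
Proof.
rewrite -lecR Re_norm {1}(complexE z) (le_trans (ler_normD _ _))//.
by rewrite rmorphD/= normrM norm_i mul1r !norm_real.
Qed.

Lemma Re_norm_ge0 z : 0 <= complex.Re `|z|.
Proof. exact: le_trans (normr_ge0 _) (norm_Re z). Qed.

Lemma Re_normD z w :
  complex.Re `|z + w| <= complex.Re `|z| + complex.Re `|w|.
Proof. by rewrite -lecR rmorphD/= !Re_norm ler_normD. Qed.

Lemma Re_distC z w : complex.Re `|z - w| = complex.Re `|w - z|.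
Proof. by rewrite distrC. Qed.

Lemma complex_gt0E (e : R[i]) : 0 < e -> exists2 r : R, 0 < r & e = r%:C.
Proof.
move=> e0; exists (complex.Re e); first by move: e0; rewrite ltcE => /andP[].
by rewrite RRe_real// gtr0_real.
Qed.

Lemma complex_complete (F : set_system R[i]^o) :
  ProperFilter F -> cauchy F -> cvg F.
Proof.
move=> FF Fc.
have H (p : R[i]^o -> R) : (forall z w, `|p z - p w| <= complex.Re `|z - w|) ->
    exists l : R, forall e, 0 < e -> \forall z \near F, `|l - p z| < e.
  move=> pL; have /cvg_ex[l lP] : cvg (p @ F).
    apply/cauchy_cvgP/cauchyP => e e0.
    have eC0 : 0 < e%:C by rewrite ltcR.
    have /cauchyP/(_ _ eC0)[z Fz] := Fc.
    exists (p z); rewrite /nbhs/=; apply: filterS Fz => w.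
    rewrite -!ball_normE/= -Re_norm ltcR; exact: le_lt_trans (pL _ _).
  by exists l => e e0; move/cvgrPdist_lt : lP => /(_ _ e0).
have [|a aP] := H (@complex.Re R).
  by move=> z w; rewrite -(raddfB (@complex.Re R)) norm_Re.
have [|b bP] := H (@complex.Im R).
  by move=> z w; rewrite -(raddfB (@complex.Im R)) norm_Im.
apply/cvg_ex; exists (a +i* b : R[i]^o).
apply/cvgrPdist_lt => _ /complex_gt0E[e e0 ->].
have e20 : 0 < e / 2 by rewrite divr_gt0.
near=> z.
rewrite -Re_norm ltcR (le_lt_trans (norm_Re_Im _))// [ltRHS]splitr ltrD//.
  rewrite (raddfB (@complex.Re R)); near: z; exact: aP.
rewrite (raddfB (@complex.Im R)); near: z; exact: bP.
Unshelve. all: by end_near. Qed.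

End ComplexComplete.

(* C(X); the proof of compactness is an argument of the type, since the sup norm
   is a norm only for compact X. *)
Definition cfun (R : realType) (X : topologicalType) (cX : compact [set: X]) :=
  continuousType X R[i]^o.

Section ContinuousFunctions.
Variables (R : realType) (X : topologicalType) (cX : compact [set: X]).
Local Notation CX := (cfun R cX).

HB.instance Definition _ := Choice.on CX.

Definition cf_eval (f : CX) : X -> R[i]^o := Continuous.sort f.
Coercion cf_eval : cfun >-> Funclass.

Lemma cf_cts (f : CX) : continuous f.
Proof. exact: cts_fun. Qed.

Lemma cfP (f g : CX) : f =1 g -> f = g.
Proof. by move=> fg; apply/continuousEP. Qed.

Definition mkcf (f : X -> R[i]^o) (cf : continuous f) : CX :=
  [the continuousType X R[i]^o of mkcts cf].

Implicit Types f g : CX.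

Lemma cf_cst_cts (a : R[i]) : continuous ((fun=> a) : X -> R[i]^o).
Proof. by move=> x; exact: cvg_cst. Qed.
Lemma cf_add_cts f g : continuous (fun x => f x + g x).
Proof. by move=> x; apply: cvgD; exact: cf_cts. Qed.
Lemma cf_opp_cts f : continuous (fun x => - f x).
Proof. by move=> x; apply: cvgN; exact: cf_cts. Qed.
Lemma cf_mul_cts f g : continuous (fun x => f x * g x : R[i]^o).
Proof. by move=> x; apply: cvgM; exact: cf_cts. Qed.
Lemma cf_conj_cts f : continuous (fun x => (f x)^* : R[i]^o).
Proof.
move=> x; apply/cvgrPdist_lt => e e0.
have /cvgrPdist_lt/(_ _ e0) := @cf_cts f x.
by apply: filterS => y; rewrite -rmorphB normcJ.
Qed.

Definition cf_cst a := mkcf (@cf_cst_cts a).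
Definition cf_add f g := mkcf (@cf_add_cts f g).
Definition cf_opp f := mkcf (@cf_opp_cts f).
Definition cf_mul f g := mkcf (@cf_mul_cts f g).
Definition cf_conj f := mkcf (@cf_conj_cts f).
Definition cf_scale (a : R[i]) f := cf_mul (cf_cst a) f.

Lemma cf_addA : associative cf_add.
Proof. by move=> f g h; apply: cfP => x; exact: addrA. Qed.
Lemma cf_addC : commutative cf_add.
Proof. by move=> f g; apply: cfP => x; exact: addrC. Qed.
Lemma cf_add0 : left_id (cf_cst 0) cf_add.
Proof. by move=> f; apply: cfP => x; exact: add0r. Qed.
Lemma cf_addN : left_inverse (cf_cst 0) cf_opp cf_add.
Proof. by move=> f; apply: cfP => x; exact: addNr. Qed.

HB.instance Definition _ :=
  GRing.isZmodule.Build CX cf_addA cf_addC cf_add0 cf_addN.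

Lemma cf_scaleA a b f : cf_scale a (cf_scale b f) = cf_scale (a * b) f.
Proof. by apply: cfP => x; exact: mulrA. Qed.
Lemma cf_scale1 : left_id 1 cf_scale.
Proof. by move=> f; apply: cfP => x; exact: mul1r. Qed.
Lemma cf_scaleDr : right_distributive cf_scale +%R.
Proof. by move=> a f g; apply: cfP => x; exact: mulrDr. Qed.
Lemma cf_scaleDl f : {morph cf_scale^~ f : a b / a + b}.
Proof. by move=> a b; apply: cfP => x; exact: mulrDl. Qed.

HB.instance Definition _ := GRing.Zmodule_isLmodule.Build R[i] CX
  cf_scaleA cf_scale1 cf_scaleDr cf_scaleDl.

Definition supnorm f : R := sup (range (fun x => complex.Re `|f x|)).

Lemma supnorm_ub f x : complex.Re `|f x| <= supnorm f.
Proof.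
apply: ub_le_sup; last by exists x.
pose n x := complex.Re `|f x|.
have nc : continuous n.
  move=> y; apply/cvgrPdist_lt => e e0.
  have eC0 : 0 < e%:C by rewrite ltcR.
  have /cvgrPdist_lt/(_ _ eC0) := @cf_cts f y.
  apply: filterS => z; rewrite -Re_norm ltcR; apply: le_lt_trans.
  rewrite -(raddfB (@complex.Re R)) (le_trans (norm_Re _))// -lecR !Re_norm.
  exact: ler_dist_dist.
have /compact_bounded[M [_ /(_ (M + 1))]] : compact (range n).
  by apply: continuous_compact => //; exact: continuous_subspaceT.
rewrite ltrDl ltr01 => /(_ isT) nM; exists (M + 1) => _ [y _ <-].
by rewrite (le_trans (ler_norm _))//; apply: nM; exists y.
Qed.

Lemma supnorm_le f (M : R) :
  0 <= M -> (forall x, complex.Re `|f x| <= M) -> supnorm f <= M.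
Proof.
move=> M0 fM; rewrite /supnorm.
have [->|/set0P[r r0]] := eqVneq (range (fun x => complex.Re `|f x|)) set0.
  by rewrite sup0.
by apply: ge_sup; [exists r|move=> _ [x _ <-]].
Qed.

Definition supnormC f : R[i] := (supnorm f)%:C.

Lemma supnorm_ge0 f : 0 <= supnorm f.
Proof.
rewrite /supnorm.
have [->|/set0P[_ [x _ _]]] := eqVneq (range (fun x => complex.Re `|f x|)) set0.
  by rewrite sup0.
exact: le_trans (Re_norm_ge0 _) (supnorm_ub f x).
Qed.

Lemma supnormD f g : supnormC (f + g) <= supnormC f + supnormC g.
Proof.
rewrite -rmorphD lecR supnorm_le ?addr_ge0 ?supnorm_ge0// => x.
exact: le_trans (Re_normD _ _) (lerD (supnorm_ub f x) (supnorm_ub g x)).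
Qed.

Lemma Re_normM (z w : R[i]) :
  complex.Re `|z * w| = complex.Re `|z| * complex.Re `|w|.
Proof. by apply: complexI; rewrite rmorphM/= !Re_norm normrM. Qed.

Lemma supnormM f g : supnorm (cf_mul f g) <= supnorm f * supnorm g.
Proof.
apply: supnorm_le; first by rewrite mulr_ge0 ?supnorm_ge0.
by move=> x; rewrite Re_normM ler_pM ?Re_norm_ge0 ?supnorm_ub.
Qed.

Lemma supnormZ_le (a : R[i]) f :
  supnorm (a *: f) <= complex.Re `|a| * supnorm f.
Proof.
apply: supnorm_le; first by rewrite mulr_ge0 ?supnorm_ge0 ?Re_norm_ge0.
by move=> x; rewrite Re_normM ler_wpM2l ?Re_norm_ge0 ?supnorm_ub.
Qed.

Lemma supnorm_eq0 f : supnormC f = 0 -> f = 0.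
Proof.
move=> /complexI f0; apply: cfP => x; apply/eqP.
change (f x == (0 : R[i])); rewrite -normr_eq0 -Re_norm; apply/eqP; congr _%:C.
by apply/eqP; rewrite eq_le Re_norm_ge0 andbT -f0 supnorm_ub.
Qed.

Lemma supnormZ (a : R[i]) f : supnormC (a *: f) = `|a| * supnormC f.
Proof.
rewrite /supnormC -[X in X * _]Re_norm -rmorphM; congr _%:C; apply/eqP.
rewrite eq_le; apply/andP; split; first exact: supnormZ_le.
have [->|a0] := eqVneq a 0.
  by rewrite normr0 mul0r supnorm_ge0.
have a0' : 0 < complex.Re `|a| by rewrite -ltcR Re_norm normr_gt0.
rewrite -ler_pdivlMl//.
have -> : (complex.Re `|a|)^-1 = complex.Re `|a^-1|.
  apply: (mulIf (lt0r_neq0 a0')).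
  by rewrite mulVf ?lt0r_neq0// -Re_normM mulVf// normr1.
by have := supnormZ_le a^-1 (a *: f); rewrite scalerA mulVf// scale1r.
Qed.

HB.instance Definition _ :=
  Lmodule_isNormed.Build R[i] CX supnormD supnormZ supnorm_eq0.

Lemma cfun_normE f : `|f| = (supnorm f)%:C. Proof. by []. Qed.

Lemma norm_cf_le f x : `|f x| <= `|f|.
Proof. by rewrite cfun_normE -Re_norm lecR supnorm_ub. Qed.

Lemma cfun_norm_le f (M : R[i]) :
  0 <= M -> (forall x, `|f x| <= M) -> `|f| <= M.
Proof.
rewrite le0r => /predU1P[->|/complex_gt0E[m m0 ->]] fM; rewrite cfun_normE.
  rewrite (_ : 0 = 0%:C)// lecR supnorm_le// => x.
  by rewrite -lecR Re_norm fM.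
by rewrite lecR supnorm_le ?(ltW m0)// => x; rewrite -lecR Re_norm fM.
Qed.

Lemma cfun_complete (F : set_system CX) : ProperFilter F -> cauchy F -> cvg F.
Proof.
move=> FF /cauchyP Fc.
have ptw (x : X) : exists l : R[i]^o, forall e : R[i], 0 < e ->
    F [set f : CX | `|l - f x| < e].
  have /cvg_ex[l lP] : cvg ((fun f : CX => f x) @ F).
    apply: complex_complete; apply/cauchyP => e e0.
    have [f Ff] := Fc _ e0; exists (f x); rewrite /nbhs/=.
    apply: filterS Ff => g; rewrite -!ball_normE/=.
    exact: le_lt_trans (norm_cf_le (f - g) x).
  by exists l => e e0; move/cvgrPdist_lt : lP => /(_ _ e0).
pose g x := sval (cid (ptw x)).
have gP x (e : R[i]) : 0 < e -> F [set f : CX | `|g x - f x| < e].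
  by move=> e0; exact: (svalP (cid (ptw x))).
have close (e : R[i]) (f : CX) : 0 < e -> F (ball f e) ->
    forall h, ball f e h -> forall x, `|g x - h x| <= e *+ 3.
  move=> e0 Ff h fh x.
  have [k [gk fk]] := filter_ex (filterI (gP x _ e0) Ff).
  rewrite -(subrKA (k x)) (le_trans (ler_normD _ _))// mulrS lerD ?(ltW gk)//.
  rewrite -(subrKA (f x)) (le_trans (ler_normD _ _))// mulr2n lerD//.
    by rewrite distrC (le_trans (norm_cf_le (f - k) x))// ltW.
  by rewrite (le_trans (norm_cf_le (f - h) x))// ltW.
have gc : continuous g.
  move=> x; apply/cvgrPdist_le => e e0.
  have e70 : 0 < e / 7%:R by rewrite divr_gt0.
  have [f Ff] := Fc _ e70; have fg := close _ _ e70 Ff f (ballxx _ e70).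
  have /cvgrPdist_le/(_ _ e70) := @cf_cts f x.
  apply: filterS => y fxy.
  rewrite -(subrKA (f x)) (le_trans (ler_normD _ _))//.
  rewrite -[e in leRHS](@divfK _ 7%:R) ?pnatr_eq0// mulr_natr (mulrnDr _ 3 4) lerD//.
  rewrite -(subrKA (f y)) (le_trans (ler_normD _ _))// mulrS lerD//.
  by rewrite distrC.
apply/cvg_ex; exists (mkcf gc); apply/cvgrPdist_le => e e0.
have e30 : 0 < e / 3%:R by rewrite divr_gt0.
have [f Ff] := Fc _ e30.
apply: filterS (Ff) => h fh; apply: cfun_norm_le (ltW e0) _ => x.
apply: le_trans (close _ _ e30 Ff h fh x) _.
by rewrite -[leLHS]mulr_natr divfK ?pnatr_eq0.
Qed.

HB.instance Definition _ := Uniform_isComplete.Build CX cfun_complete.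

Lemma cf_mulA : associative cf_mul.
Proof. by move=> f g h; apply: cfP => x; exact: mulrA. Qed.
Lemma cf_mul1 : left_id (cf_cst 1) cf_mul.
Proof. by move=> f; apply: cfP => x; exact: mul1r. Qed.
Lemma cf_mulr1 : right_id (cf_cst 1) cf_mul.
Proof. by move=> f; apply: cfP => x; exact: mulr1. Qed.
Lemma cf_mulDl : left_distributive cf_mul +%R.
Proof. by move=> f g h; apply: cfP => x; exact: mulrDl. Qed.
Lemma cf_mulDr : right_distributive cf_mul +%R.
Proof. by move=> f g h; apply: cfP => x; exact: mulrDr. Qed.
Lemma cf_scaleAl (a : R[i]) f g : a *: cf_mul f g = cf_mul (a *: f) g.
Proof. by apply: cfP => x; exact: mulrA. Qed.
Lemma cf_scaleAr (a : R[i]) f g : a *: cf_mul f g = cf_mul f (a *: g).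
Proof. by apply: cfP => x; exact: mulrCA. Qed.
Lemma cf_conjK : involutive cf_conj.
Proof. by move=> f; apply: cfP => x; exact: conjcK. Qed.
Lemma cf_conjD : {morph cf_conj : f g / f + g}.
Proof. by move=> f g; apply: cfP => x; exact: rmorphD. Qed.
Lemma cf_conjZ (a : R[i]) f : cf_conj (a *: f) = a^* *: cf_conj f.
Proof. by apply: cfP => x; exact: rmorphM. Qed.
Lemma cf_conjM f g : cf_conj (cf_mul f g) = cf_mul (cf_conj g) (cf_conj f).
Proof. apply: cfP => x; change ((f x * g x : R[i])^* = (g x)^* * (f x)^*).
by rewrite rmorphM mulrC. Qed.
Lemma cf_normM f g : `|cf_mul f g| <= `|f| * `|g|.
Proof. by rewrite !cfun_normE -rmorphM lecR supnormM. Qed.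

Lemma cf_norm_conjM f : `|cf_mul (cf_conj f) f| = `|f| ^+ 2.
Proof.
rewrite !cfun_normE -rmorphXn; congr _%:C; apply/eqP; rewrite eq_le.
have E x : complex.Re `|cf_mul (cf_conj f) f x| = (complex.Re `|f x|) ^+ 2.
  rewrite Re_normM expr2; congr (complex.Re _ * _).
  exact: normcJ.
apply/andP; split.
  apply: supnorm_le; first by rewrite sqr_ge0.
  by move=> x; rewrite E ler_pXn2r ?nnegrE ?Re_norm_ge0 ?supnorm_ge0 ?supnorm_ub.
rewrite -[leRHS]sqr_sqrtr ?supnorm_ge0// ler_pXn2r ?nnegrE ?sqrtr_ge0 ?supnorm_ge0//.
apply: supnorm_le => [|x]; first by rewrite sqrtr_ge0.
rewrite -[leLHS]ger0_norm ?Re_norm_ge0// -sqrtr_sqr ler_wsqrtr// -E.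
exact: supnorm_ub.
Qed.

HB.instance Definition _ := isCStarAlgebra.Build R CX
  cf_mulA cf_mul1 cf_mulr1 cf_mulDl cf_mulDr cf_scaleAl cf_scaleAr
  cf_conjK cf_conjD cf_conjZ cf_conjM cf_normM cf_norm_conjM.

End ContinuousFunctions.

Section OperatorSystems.
Variable R : realType.
Implicit Types A B C D I : cstarAlgType R.

Definition cstar_hom A B (f : A -> B) : Prop :=
  [/\ linear f, f cunit = cunit, {morph f : x y / x ** y}
    & {morph f : x / star x}].

Definition cstar_inclusion A B (f : A -> B) : Prop :=
  cstar_hom f /\ injective f.

(* M is positive in the C*-algebra M_n(A), i.e., M = N^* N *)
Definition psdmx A n (M : 'M[A]_n) : Prop :=
  exists N : 'M[A]_n, forall i j, M i j = \sum_k star (N k i) ** N k j.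

(* The C*-norm of M_n(A), as the operator norm for its action on the Hilbert
   A-module A^n, whose inner product is <x, y> = \sum_i x_i^* y_i. *)
Definition hmnorm A n (x : 'cV[A]_n) : R :=
  Num.sqrt (complex.Re `|\sum_i star (x i 0) ** x i 0|).

Definition mxact A n (M : 'M[A]_n) (x : 'cV[A]_n) : 'cV[A]_n :=
  \col_i \sum_j M i j ** x j 0.

Definition mxcnorm A n (M : 'M[A]_n) : R :=
  sup [set hmnorm (mxact M x) | x in [set x : 'cV[A]_n | hmnorm x <= 1]].

(* Operator systems are concrete: unital self-adjoint subspaces of unital
   C*-algebras.  A map between operator systems S and T is given by a function
   on the ambient algebras, of which only the restriction to S matters. *)
Definition operator_system A (S : set A) : Prop :=
  [/\ S cunit, forall (a : R[i]) x y, S x -> S y -> S (a *: x + y)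
    & forall x, S x -> S (star x)].

Definition mx_over A n (S : set A) (M : 'M[A]_n) : Prop := forall i j, S (M i j).

Definition linear_on A B (S : set A) (f : A -> B) : Prop :=
  forall (a : R[i]) x y, S x -> S y -> f (a *: x + y) = a *: f x + f y.

Definition ucp A B (S : set A) (T : set B) (f : A -> B) : Prop :=
  [/\ forall x, S x -> T (f x), linear_on S f, f cunit = cunit
    & forall n (M : 'M[A]_n), mx_over S M -> psdmx M -> psdmx (map_mx f M)].

Definition unital_complete_isometry A B (S : set A) (T : set B) (f : A -> B) :=
  [/\ forall x, S x -> T (f x), linear_on S f, f cunit = cunit
    & forall n (M : 'M[A]_n), mx_over S M -> mxcnorm (map_mx f M) = mxcnorm M].

Definition injective_opsys B (T : set B) : Prop :=
  forall A (E F : set A), operator_system E -> operator_system F -> E `<=` F ->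
  forall f : A -> B, ucp E T f ->
  exists2 g : A -> B, ucp F T g & forall x, E x -> g x = f x.

Definition injective_envelope D I (iota : D -> I) : Prop :=
  [/\ cstar_inclusion iota, injective_opsys [set: I] &
    forall B (S : set B), operator_system S -> injective_opsys S ->
    forall tau : D -> B, unital_complete_isometry [set: D] S tau ->
    exists2 tau1 : I -> B, unital_complete_isometry [set: I] S tau1
      & forall d, tau1 (iota d) = tau d].

Definition pseudo_expectation C D I (incl : D -> C) (iota : D -> I)
    (Phi : C -> I) : Prop :=
  ucp [set: C] [set: I] Phi /\ forall d, Phi (incl d) = iota d.

Definition multiplicative_pseudo_expectation C D I (incl : D -> C)
    (iota : D -> I) (Phi : C -> I) : Prop :=
  pseudo_expectation incl iota Phi /\ cstar_hom Phi.

Definition closed_ideal C (J : set C) : Prop :=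
  [/\ closed J, J 0, forall (a : R[i]) x y, J x -> J y -> J (a *: x + y)
    & forall x y, J y -> J (x ** y) /\ J (y ** x)].

Definition disjoint_ideal C D (incl : D -> C) (J : set C) : Prop :=
  closed_ideal J /\ range incl `&` J = [set 0].

Definition maximal_disjoint_ideal C D (incl : D -> C) (J : set C) : Prop :=
  disjoint_ideal incl J /\
  forall J', disjoint_ideal incl J' -> J `<=` J' -> J' = J.

End OperatorSystems.

Section Pullback.
Variables (R : realType) (X Y : topologicalType).
Variables (cX : compact [set: X]) (cY : compact [set: Y]).
Variables (j : Y -> X) (cj : continuous j).

Lemma pullback_cts (f : cfun R cX) : continuous (f \o j).
Proof. by move=> y; apply: continuous_comp; [exact: cj|exact: cf_cts]. Qed.

Definition pullback (f : cfun R cX) : cfun R cY := mkcf cY (@pullback_cts f).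

Lemma pullback_inclusion : j @` [set: Y] = [set: X] -> cstar_inclusion pullback.
Proof.
move=> sj; split; first by split => [a f g||f g|f]; exact: cfP.
move=> f g fg; apply: cfP => x.
have [y _ <-] : (j @` [set: Y]) x by rewrite sj.
exact: (congr1 (fun h : cfun R cY => h y) fg).
Qed.

End Pullback.

Arguments pullback {R X Y} cX cY {j} cj f.

Section MinimalCover.
Variables (X Y : topologicalType) (j : Y -> X).

Definition covering_closed_set (K : set Y) : Prop :=
  closed K /\ j @` K = [set: X].

Definition minimal_covering_closed_set (K : set Y) : Prop :=
  covering_closed_set K /\
  forall K', covering_closed_set K' -> K' `<=` K -> K' = K.

End MinimalCover.

(* Main.v *)
Require Import Defs.
From HB Require Import structures.
From mathcomp Require Import all_boot all_order all_algebra.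
From mathcomp Require Import all_classical all_reals topology normedtype.
From mathcomp Require Import complex.
From mathcomp Require Import ring lra.

Set Implicit Arguments.
Unset Strict Implicit.
Unset Printing Implicit Defensive.

Import Order.TTheory GRing.Theory Num.Theory numFieldNormedType.Exports.

Local Open Scope classical_set_scope.
Local Open Scope ring_scope.
Local Open Scope complex_scope.

(** The injective envelope of [C(X)] is the algebra [C(G)] of an irreducible
    cover [p : G -> X], and in this model the four conditions become statements
    about closed subsets of [Y] that are mapped onto [X].

    For [G] one can take a closed subset of the space of ultrafilters on [X] that
    is minimal among those on which the limit map [p] is onto [X]. Limits along
    ultrafilters extend maps from the set [X], so [p] lifts to every closed
    subset of [Y] that is mapped onto [X] ([beta_lift]). For the same reason
    [C(G)] is injective ([cover_injective]): at the points of a section of [p]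
    one extends states by Hahn-Banach, and these points are then moved along
    ultrafilters.

    The heart of the matter is [positive_over_unique]: if [Y] has a least closed
    subset [K] that is mapped onto [X], then there is at most one unital positive
    map [C(Y) -> C(G)] that extends [p^* : C(X) -> C(G)]. The state at [g] given
    by such a map lives on the fibre of [j] over [p g]. If two such maps were
    separated by constants [c < d] at some [f], they would be so over a nonempty
    open subset [W] of [X], and on all fibres over [W] the function [f] would
    take values below [c] and values above [d]. Then [K] would be contained in
    two closed subsets of [Y] that are mapped onto [X] and have no common point
    over [W]. The case [Y = G] is the rigidity of [C(G)].

    The universal property of [I] gives an isometry [u : I -> C(G)], the
    injectivity of [I] gives a completely positive [v : C(G) -> I], and [u o v]
    is the identity by rigidity. The Schwarz inequality holds for [u] and for
    [v], so that [v] is a *-isomorphism ([envelope_iso]).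

    Now pseudo-expectations are the unital positive maps [C(Y) -> C(G)] over
    [C(X)]. A lift [q : G -> Y] of [p] to a minimal [K] is onto [K], and [q^*] is
    multiplicative. So there always is a multiplicative pseudo-expectation,
    different [K] give different ones, and if there is only one [K] then it is
    contained in all closed subsets that are mapped onto [X], so that the
    pseudo-expectation is unique. Minimal [K] and maximal disjoint ideals
    correspond to each other as kernels and hulls ([unique_ideal_cover]).

    Two facts on positivity are behind this. In a C*-algebra [a^* a] is the
    square of a selfadjoint element ([adjM_sqr]), so that functionals dominated
    by the norm are positive; and a matrix of continuous functions that is
    positive at every point has a continuous square root
    ([psdmx_pointwise]), so that positive maps between algebras of continuous
    functions are completely positive. *)

(** * Norms with real values *)

Section RealNorm.
Context {R : realType}.

Definition rnorm {V : normedModType R[i]} (x : V) : R := complex.Re `|x|.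

Section Normed.
Variable V : normedModType R[i].
Implicit Types x y : V.

Lemma rnormE x : `|x| = (rnorm x)%:C.
Proof. by rewrite /rnorm RRe_real// ger0_real. Qed.

Lemma rnorm_ge0 x : 0 <= rnorm x.
Proof. by rewrite -lecR -rnormE normr_ge0. Qed.

Lemma rnorm0 : rnorm (0 : V) = 0.
Proof. by rewrite /rnorm normr0. Qed.

Lemma rnormD x y : rnorm (x + y) <= rnorm x + rnorm y.
Proof. by rewrite -lecR rmorphD/= -!rnormE ler_normD. Qed.

Lemma rnormN x : rnorm (- x) = rnorm x.
Proof. by rewrite /rnorm normrN. Qed.

Lemma rnormB x y : rnorm (x - y) <= rnorm x + rnorm y.
Proof. by rewrite -(rnormN y) rnormD. Qed.

Lemma rdistC x y : rnorm (x - y) = rnorm (y - x).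
Proof. by rewrite -rnormN opprB. Qed.

Lemma rnormBD z x y : rnorm (x - y) <= rnorm (x - z) + rnorm (z - y).
Proof. by rewrite -{1}(subrKA z) rnormD. Qed.

Lemma rnormZ (a : R[i]) x : rnorm (a *: x) = rnorm (a : R[i]^o) * rnorm x.
Proof. by apply: complexI; rewrite rmorphM/= -!rnormE normrZ. Qed.

Lemma rnorm_eq0 x : rnorm x <= 0 -> x = 0.
Proof.
move=> x0; apply/normr0_eq0; rewrite rnormE; congr _%:C.
by apply/eqP; rewrite eq_le x0 rnorm_ge0.
Qed.

End Normed.

Lemma rnormR (r : R) : rnorm (r%:C : R[i]^o) = `|r|.
Proof. by rewrite /rnorm norm_real. Qed.

Lemma rnormZR (V : normedModType R[i]) (r : R) (x : V) :
  rnorm (r%:C *: x) = `|r| * rnorm x.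
Proof. by rewrite rnormZ rnormR. Qed.

Lemma rnormZi (V : normedModType R[i]) (x : V) : rnorm ('i%C *: x) = rnorm x.
Proof. by rewrite rnormZ {1}/rnorm norm_i mul1r. Qed.

(** The limit inherits the bound of the tail, so that no limits need to be taken
    when the lemma is used. *)
Lemma complete_limit (V : completeNormedModType R[i]) (y : nat -> V)
    (e : nat -> R) :
  (forall n m, (n <= m)%N -> rnorm (y m - y n) <= e n) ->
  (forall eps, 0 < eps -> exists n, e n < eps) ->
  exists l, forall n, rnorm (l - y n) <= e n.
Proof.
move=> ye e0.
have /cauchy_cvgP/cvg_ex[l lP] : cauchy (y @ \oo).
  apply/cauchyP => _ /complex_gt0E[eps eps0 ->].
  have [n en] := e0 _ eps0; exists (y n); exists n => // m /= nm.
  by rewrite -ball_normE/= rnormE ltcR rdistC (le_lt_trans (ye _ _ nm)).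
exists l => n; apply/ler_addgt0Pr => eps eps0.
have eps0' : 0 < eps%:C by rewrite ltcR.
move/cvgrPdist_lt : lP => /(_ _ eps0')[N _ Nl].
have := Nl (maxn n N) (leq_maxr _ _); rewrite rnormE ltcR => /ltW lm.
have := rnormBD (y (maxn n N)) l (y n); move: (ye n _ (leq_maxl n N)) => yn.
by move=> /le_trans; apply; rewrite addrC lerD.
Qed.

End RealNorm.

(** * The scalar iteration behind square roots *)

Section SquareRootIteration.
Variable R : realType.

(** Distance to [1] of the iterates of [t |-> (1 + t ^ 2) / 2] from [0]. *)
Fixpoint sqrt_err (n : nat) : R :=
  if n is n'.+1 then sqrt_err n' - sqrt_err n' ^+ 2 / 2%:R else 1.

Lemma sqrt_err_bound n : 0 <= sqrt_err n <= 2%:R / n.+2%:R.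
Proof.
have step (k : R) : 0 < k ->
    2%:R / k - (2%:R / k) ^+ 2 / 2%:R <= 2%:R / (k + 1).
  move=> k0.
  have -> : 2%:R / k - (2%:R / k) ^+ 2 / 2%:R = 2%:R * (k - 1) / (k ^+ 2).
    by field; rewrite gt_eqF.
  rewrite ler_pdivrMr ?exprn_gt0// mulrAC ler_pdivlMr; last by lra.
  by nra.
elim: n => [|n /andP[e0 eb]]/=; first by rewrite ler01 divff ?lexx// pnatr_eq0.
have k0 : (0 : R) < n.+2%:R by rewrite ltr0n.
have b1 : 2%:R / n.+2%:R <= 1 :> R by rewrite ler_pdivrMr ?mul1r ?ler_nat.
have e1 := le_trans eb b1.
apply/andP; split; first by nra.
have kinv : 0 < n.+2%:R^-1 :> R by rewrite invr_gt0.
apply: (@le_trans _ _ (2%:R / n.+2%:R - (2%:R / n.+2%:R) ^+ 2 / 2%:R)).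
  move: (sqrt_err n) (2%:R / n.+2%:R) e1 b1 eb => a b a1 b1 ab.
  have : 0 <= (b - a) * (1 - (a + b) / 2%:R) by apply: mulr_ge0; lra.
  by rewrite !expr2; lra.
by rewrite (le_trans (step _ k0))// natr1.
Qed.

Lemma sqrt_err_ge0 n : 0 <= sqrt_err n.
Proof. by have /andP[] := sqrt_err_bound n. Qed.

Lemma sqrt_err_decr n m : (n <= m)%N -> sqrt_err m <= sqrt_err n.
Proof.
move=> /subnK <-; elim: (m - n)%N => [//|k IH]; rewrite addSn/=.
by rewrite (le_trans _ IH)// gerBl divr_ge0 ?sqr_ge0.
Qed.

Lemma sqrt_err_le1 n : sqrt_err n <= 1.
Proof. exact: sqrt_err_decr (leq0n n). Qed.

Lemma sqrt_err_cvg0 eps : 0 < eps -> exists n, sqrt_err n < eps.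
Proof.
move=> e0; have e20 : 0 < eps / 2%:R by rewrite divr_gt0.
exists (Num.truncn (eps / 2%:R)^-1);
  have /andP[_ /le_lt_trans] := sqrt_err_bound (Num.truncn (eps / 2%:R)^-1);
    apply.
set n := Num.truncn _.
have : (eps / 2%:R)^-1 < n.+1%:R by apply: truncnS_gt.
rewrite invf_div ltr_pdivrMr// => H.
rewrite ltr_pdivrMr ?ltr0n// mulrC (lt_trans H)// ltr_pM2r// ltr_nat//.
Qed.

End SquareRootIteration.

(** * Square roots and positivity in a C*-algebra *)

(** The underlying type of a C*-algebra, on which the product is the one of a
    possibly zero ring, so that the generic theory of rings applies. *)
Definition cring (R : realType) (A : cstarAlgType R) : Type := A.

Section CRingInstances.
Variables (R : realType) (A : cstarAlgType R).
HB.instance Definition _ := CompleteNormedModule.copy (cring A) A.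
HB.instance Definition _ := GRing.Zmodule_isPzRing.Build (cring A)
  (@cmulA R A) (@cmul1x R A) (@cmulx1 R A) (@cmulDl R A) (@cmulDr R A).
End CRingInstances.

Section CStar.
Variables (R : realType) (A : cstarAlgType R).
Local Notation C := (cring A).
Implicit Types (a : R[i]) (x y z : C).

Definition adj x : C := star (x : A).
Definition selfadj x := adj x = x.

Lemma cscalerAl a x y : a *: (x * y) = (a *: x) * y.
Proof. exact: cscaleAl. Qed.
Lemma cscalerAr a x y : a *: (x * y) = x * (a *: y).
Proof. exact: cscaleAr. Qed.

Lemma scaler_ii x : 'i%C *: ('i%C *: x) = - x.
Proof.
rewrite scalerA -scaleN1r; congr (_ *: _); apply/eqP.
by rewrite eq_complex/= !mul0r mulr0 mul1r sub0r addr0 oppr0 !eqxx.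
Qed.
Lemma scaler_half x : (2%:R^-1 : R)%:C *: (x + x) = x.
Proof.
rewrite scalerDr -scalerDl -rmorphD/= (_ : _ + _ = 1) ?scale1r//.
by rewrite [RHS]splitr mul1r.
Qed.

Lemma adjK x : adj (adj x) = x. Proof. exact: starK. Qed.
Lemma adjD x y : adj (x + y) = adj x + adj y. Proof. exact: starD. Qed.
Lemma adjM x y : adj (x * y) = adj y * adj x. Proof. exact: starM. Qed.
Lemma adjZ a x : adj (a *: x) = a^*%C *: adj x. Proof. exact: starZ. Qed.
Lemma adj0 : adj 0 = 0.
Proof. by rewrite -[in LHS](scale0r (0 : C)) adjZ rmorph0 scale0r. Qed.
Lemma adjN x : adj (- x) = - adj x.
Proof. by rewrite -[in LHS]scaleN1r adjZ rmorphN1 scaleN1r. Qed.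
Lemma adjB x y : adj (x - y) = adj x - adj y.
Proof. by rewrite adjD adjN. Qed.
Lemma adjZR (r : R) x : adj (r%:C *: x) = r%:C *: adj x.
Proof. by rewrite adjZ conjc_real. Qed.
Lemma adjZi x : adj ('i%C *: x) = - ('i%C *: adj x).
Proof. by rewrite adjZ -scaleNr; congr (_ *: _); apply/eqP;
  rewrite eq_complex/= oppr0 !eqxx. Qed.
Lemma adj1 : adj 1 = 1.
Proof. by have := adjM (adj 1) 1; rewrite mulr1 adjK mulr1. Qed.

Lemma rnormM x y : rnorm (x * y) <= rnorm x * rnorm y.
Proof. by rewrite -lecR rmorphM/= -!rnormE; exact: cnormM. Qed.

Lemma rnorm_adjM x : rnorm (adj x * x) = rnorm x ^+ 2.
Proof. by apply: complexI; rewrite rmorphXn/= -!rnormE;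
  exact: cstar_identity. Qed.

Lemma rnorm_adj x : rnorm (adj x) = rnorm x.
Proof.
suff H z : rnorm z <= rnorm (adj z) by apply/eqP;
  rewrite eq_le H -{2}(adjK x) H.
have [z0|z0] := leP (rnorm z) 0; first exact: le_trans z0 (rnorm_ge0 _).
by rewrite -(ler_pM2r z0) -expr2 -rnorm_adjM rnormM.
Qed.

Lemma rnorm_sqr x : selfadj x -> rnorm (x ^+ 2) = rnorm x ^+ 2.
Proof. by move=> xs; rewrite -rnorm_adjM xs. Qed.

Lemma selfadj1 : selfadj 1. Proof. exact: adj1. Qed.
Lemma selfadjD x y : selfadj x -> selfadj y -> selfadj (x + y).
Proof. by rewrite /selfadj adjD => -> ->. Qed.
Lemma selfadjB x y : selfadj x -> selfadj y -> selfadj (x - y).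
Proof. by rewrite /selfadj adjB => -> ->. Qed.
Lemma selfadjN x : selfadj x -> selfadj (- x).
Proof. by rewrite /selfadj adjN => ->. Qed.
Lemma selfadjZ (r : R) x : selfadj x -> selfadj (r%:C *: x).
Proof. by rewrite /selfadj adjZR => ->. Qed.
Lemma selfadjM x y : selfadj x -> selfadj y -> x * y = y * x -> selfadj (x * y).
Proof. by rewrite /selfadj adjM => -> -> ->. Qed.
Lemma selfadjX x n : selfadj x -> selfadj (x ^+ n).
Proof.
move=> xs; elim: n => [|n IH]; first by rewrite /selfadj expr0 adj1.
by rewrite /selfadj exprS adjM IH xs -exprSr exprS.
Qed.
Lemma selfadj_adjM x : selfadj (adj x * x).
Proof. by rewrite /selfadj adjM adjK. Qed.

Lemma rnorm1_le1 : rnorm (1 : C) <= 1.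
Proof.
have := rnorm_sqr selfadj1; rewrite expr1n => n1.
by have := rnorm_ge0 (1 : C); nra.
Qed.

Lemma sqrt_err_eq0 z (k : R) : (forall n, rnorm z <= k * sqrt_err R n) -> z = 0.
Proof.
move=> zk; apply: rnorm_eq0; rewrite leNgt; apply/negP => z0.
have k0 : 0 < k by have := zk 0%N; rewrite /= mulr1; apply: lt_le_trans.
have [n] := sqrt_err_cvg0 (divr_gt0 z0 k0).
by rewrite ltr_pdivlMr// mulrC ltNge zk.
Qed.

Section Iteration.
Variable x : C.
Hypothesis x1 : rnorm x <= 1.
Local Notation h := ((2%:R^-1 : R)%:C).

Fixpoint sqrt_iter n : C :=
  if n is n'.+1 then h *: (x + sqrt_iter n' ^+ 2) else 0.

Let rnormh y : rnorm (h *: y) = rnorm y / 2%:R.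
Proof. by rewrite rnormZR ger0_norm ?invr_ge0// mulrC. Qed.

Lemma sqrt_iter_norm n : rnorm (sqrt_iter n) <= 1 - sqrt_err R n.
Proof.
elim: n => [|n IH]/=; first by rewrite rnorm0 subrr.
rewrite rnormh; have := rnormD x (sqrt_iter n ^+ 2).
have := rnormM (sqrt_iter n) (sqrt_iter n); rewrite -!expr2.
have := rnorm_ge0 (sqrt_iter n); have := sqrt_err_ge0 R n; move: IH x1.
move: (rnorm x) (rnorm (_ + _)) (rnorm (sqrt_iter n ^+ 2)).
move: (rnorm (sqrt_iter n)) => d a b c; move: (sqrt_err R n) => e; nra.
Qed.

Lemma subr_sqr_cring y z : y ^+ 2 - z ^+ 2 = y * (y - z) + (y - z) * z.
Proof. by rewrite mulrBr mulrBl addrA subrK. Qed.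

Lemma sqrt_iter_dist n m : (n <= m)%N ->
  rnorm (sqrt_iter m - sqrt_iter n) <= sqrt_err R n - sqrt_err R m.
Proof.
elim: n m => [|n IH] m; first by move=> _; rewrite subr0; exact: sqrt_iter_norm.
case: m => // m nm /=.
rewrite -scalerBr opprD addrACA subrr add0r rnormh subr_sqr_cring.
have := rnormD (sqrt_iter m * (sqrt_iter m - sqrt_iter n))
  ((sqrt_iter m - sqrt_iter n) * sqrt_iter n).
have := rnormM (sqrt_iter m) (sqrt_iter m - sqrt_iter n).
have := rnormM (sqrt_iter m - sqrt_iter n) (sqrt_iter n).
move: (IH m nm) (sqrt_iter_norm n) (sqrt_iter_norm m).
move: (rnorm_ge0 (sqrt_iter m - sqrt_iter n)).
move: (rnorm_ge0 (sqrt_iter m)) (rnorm_ge0 (sqrt_iter n)).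
move: (rnorm (_ + _)) (rnorm (_ * _ : C)) (rnorm (_ * _ : C)) => p q r.
move: (rnorm (_ - _)) (rnorm _) (rnorm _) => d yn ym.
move: (sqrt_err R n) (sqrt_err R m) => en em ym0 yn0 d0 dl ynl yml.
move=> H1 H2 H3.
have H4 : d * yn <= (en - em) * (1 - en) by apply: ler_pM.
have H5 : ym * d <= (1 - em) * (en - em) by apply: ler_pM.
by rewrite !expr2; lra.
Qed.

(** The smallest solution [y] of [y = (x + y ^ 2) / 2] is the sum of a power
    series in [x] with nonnegative coefficients, so the iterates converge in
    norm at the speed at which they do for [x = 1]. *)
Lemma sqrt_fixpoint : exists y, [/\ y + y = x + y ^+ 2, rnorm y <= 1,
  selfadj x -> selfadj y & forall z, z * x = x * z -> z * y = y * z].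
Proof.
have [n m nm|eps e0|y yP] := @complete_limit R C sqrt_iter (sqrt_err R).
- by rewrite (le_trans (sqrt_iter_dist nm))// gerBl sqrt_err_ge0.
- exact: sqrt_err_cvg0.
have y1 : rnorm y <= 1 by have := yP 0%N; rewrite subr0.
have Y1 n : rnorm (sqrt_iter n) <= 1.
  by rewrite (le_trans (sqrt_iter_norm n))// gerBl sqrt_err_ge0.
exists y; split=> //.
- suff E : y = h *: (x + y ^+ 2).
    rewrite [in LHS]E -scalerDl -rmorphD/= (_ : _ + _ = 1) ?scale1r//.
    by rewrite [RHS]splitr mul1r.
  apply: subr0_eq; apply: (@sqrt_err_eq0 _ 2%:R) => n.
  apply: le_trans (rnormBD (sqrt_iter n.+1) _ _) _ => /=.
  rewrite -scalerBr opprD addrACA subrr add0r rnormh subr_sqr_cring.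
  have := yP n.+1 => /=.
  have := rnormD (sqrt_iter n * (sqrt_iter n - y)) ((sqrt_iter n - y) * y).
  have := rnormM (sqrt_iter n) (sqrt_iter n - y).
  have := rnormM (sqrt_iter n - y) y.
  have : rnorm (sqrt_iter n - y) <= sqrt_err R n.
    by rewrite rdistC; exact: yP.
  move: (Y1 n) y1 (sqrt_err_ge0 R n).
  move: (rnorm_ge0 (sqrt_iter n - y)) (rnorm_ge0 y) (rnorm_ge0 (sqrt_iter n)).
  move: (rnorm (_ + _)) (rnorm (_ * _ : C)) (rnorm (_ * _ : C)) => p q r.
  move: (rnorm (y - _ *: _)) => w.
  move: (rnorm (sqrt_iter n - y)) (rnorm y) (rnorm (sqrt_iter n)).
  move: (sqrt_err R n) => e d ny yn.
  move=> d0 ny0 yn0 yn1 ny1 e0 de H1 H2 H3 H4.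
  have H5 : d * ny <= d by rewrite ler_piMr.
  have H6 : yn * d <= d by rewrite ler_piMl.
  by have := sqr_ge0 e; lra.
- move=> xs; have Ys n : selfadj (sqrt_iter n).
    elim: n => [|n IH]/=; first exact: adj0.
    by apply: selfadjZ; apply: selfadjD => //; exact: selfadjX.
  apply: subr0_eq; apply: (@sqrt_err_eq0 _ 2%:R) => n.
  apply: le_trans (rnormBD (sqrt_iter n) _ _) _.
  rewrite -{1}(Ys n) -adjB rnorm_adj rdistC mulr2n mulrDl mul1r.
  by rewrite lerD// rdistC; exact: yP.
- move=> z zx; have Yz n : z * sqrt_iter n = sqrt_iter n * z.
    elim: n => [|n IH]/=; first by rewrite mulr0 mul0r.
    rewrite -cscalerAr -cscalerAl mulrDr mulrDl zx; congr (_ *: (_ + _)).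
    by rewrite expr2 mulrA IH -mulrA IH mulrA.
  apply: subr0_eq; apply: (@sqrt_err_eq0 _ (rnorm z *+ 2)) => n.
  rewrite (_ : _ - _ = z * (y - sqrt_iter n) - (y - sqrt_iter n) * z);
    last first.
    by rewrite mulrBr mulrBl Yz opprB addrA subrK.
  apply: le_trans (rnormB _ _) _; rewrite mulr2n [leRHS]mulrDl lerD//.
    by rewrite (le_trans (rnormM _ _))// ler_wpM2l ?rnorm_ge0 ?yP.
  by rewrite (le_trans (rnormM _ _))// mulrC ler_wpM2l ?rnorm_ge0 ?yP.
Qed.

End Iteration.

(** The square root of [h] provided by the fixed point [y] for [x = 1 - h] is
    [1 - y]. *)
Lemma sqrt_exists h : selfadj h -> rnorm (1 - h) <= 1 ->
  exists b, [/\ h = b ^+ 2, selfadj b, rnorm (1 - b) <= 1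
    & forall z, z * h = h * z -> z * b = b * z].
Proof.
move=> hs h1; have [y [yE y1 ys yc]] := sqrt_fixpoint h1.
exists (1 - y); split.
- rewrite expr2 mulrBl mul1r mulrBr mulr1 -addrA -opprD.
  by rewrite (_ : y + (y - y * y) = y + y - y ^+ 2) ?addrA// yE addrK subKr.
- by apply: selfadjB; [exact: selfadj1|apply: ys; exact: selfadjB selfadj1 hs].
- by rewrite subKr.
- move=> z zh; rewrite mulrBr mulrBl mulr1 mul1r yc//.
  by rewrite mulrBr mulrBl zh mulr1 mul1r.
Qed.

Lemma adj_addi_mul b k : selfadj b -> selfadj k -> b * k = k * b ->
  adj (b + 'i%C *: k) * (b + 'i%C *: k) = b ^+ 2 + k ^+ 2.
Proof.
move=> bs ks bk; rewrite adjD adjZi bs ks mulrBl !mulrDr -!cscalerAl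
  -!cscalerAr.
by rewrite scaler_ii bk opprD opprK addrA addrK -!expr2.
Qed.

Lemma adj_subi_mul b k : selfadj b -> selfadj k ->
  2%:R *: ('i%C *: k) = (b + 'i%C *: k) - adj (b + 'i%C *: k).
Proof.
by move=> bs ks; rewrite adjD adjZi bs ks opprB [X in _ + X]addrC addrACA subrr
  add0r scaler_nat mulr2n.
Qed.

(** With [s] a square root of [1 - b ^ 2], the element [b + i s] is unitary. *)
Lemma rnorm_1Bsqr b : selfadj b -> rnorm b <= 1 -> rnorm (1 - b ^+ 2) <= 1.
Proof.
move=> bs b1.
have b21 : rnorm (1 - (1 - b ^+ 2)) <= 1.
  by rewrite subKr rnorm_sqr// expr_le1// rnorm_ge0.
have b2s : selfadj (1 - b ^+ 2) by apply: selfadjB;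
  [exact: selfadj1|exact: selfadjX].
have [s [sE ss _ sc]] := sqrt_exists b2s b21.
have bsc : b * s = s * b.
  by apply: sc; rewrite mulrBr mulrBl mulr1 mul1r -exprS -exprSr.
rewrite sE rnorm_sqr// expr_le1 ?rnorm_ge0//.
have := adj_addi_mul bs ss bsc; rewrite -sE [X in _ = X]addrC subrK => u1.
have nu : rnorm (b + 'i%C *: s) <= 1.
  rewrite -(@expr_le1 _ 2)// ?rnorm_ge0// -rnorm_adjM u1; exact: rnorm1_le1.
have := congr1 (@rnorm R C) (adj_subi_mul bs ss).
rewrite -(rmorph_nat (real_complex R)) rnormZR ger0_norm// rnormZi => E.
have := rnormB (b + 'i%C *: s) (adj (b + 'i%C *: s)).
by rewrite -E rnorm_adj; lra.
Qed.

Definition sqr_selfadj x := exists2 b, selfadj b & x = b ^+ 2.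

Lemma sqr_selfadjZ (r : R) x : 0 <= r -> sqr_selfadj x ->
  sqr_selfadj (r%:C *: x).
Proof.
move=> r0 [b bs ->]; exists ((Num.sqrt r)%:C *: b); first exact: selfadjZ.
by rewrite !expr2 -cscalerAl -cscalerAr scalerA -rmorphM -[Num.sqrt r * _]expr2
  sqr_sqrtr.
Qed.

Lemma sqr_selfadj_selfadj x : sqr_selfadj x -> selfadj x.
Proof. by move=> [b bs ->]; exact: selfadjX. Qed.

Lemma sqr_selfadj_norm x : sqr_selfadj x -> rnorm x <= 1 -> rnorm (1 - x) <= 1.
Proof.
move=> [b bs ->]; rewrite rnorm_sqr// expr_le1 ?rnorm_ge0// => b1.
exact: rnorm_1Bsqr.
Qed.

Lemma sqr_selfadj_of_norm x : selfadj x -> rnorm (1 - x) <= 1 -> sqr_selfadj x.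
Proof. by move=> xs /(sqrt_exists xs)[b [-> bs _ _]]; exists b. Qed.

Lemma rescale x y : exists2 r : R, 0 < r &
  rnorm (r%:C *: x) <= 1 /\ rnorm (r%:C *: y) <= 1.
Proof.
have x0 := rnorm_ge0 x; have y0 := rnorm_ge0 y.
have s0 : 0 < 1 + rnorm x + rnorm y by lra.
exists (1 + rnorm x + rnorm y)^-1; first by rewrite invr_gt0.
by rewrite !rnormZR gtr0_norm ?invr_gt0// !ler_pdivrMl// mulr1; lra.
Qed.

Lemma scalerKR (r : R) x : 0 < r -> x = (r^-1)%:C *: (r%:C *: x).
Proof. by move=> r0; rewrite scalerA -rmorphM mulVf ?scale1r// gt_eqF. Qed.

(** For [x] and [y] of norm at most [1], the distance from [1] to [(x + y) / 2]
    is the mean of two numbers that are at most [1]. *)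
Lemma sqr_selfadjD x y : sqr_selfadj x -> sqr_selfadj y -> sqr_selfadj (x + y).
Proof.
move=> xs ys; have [r r0 [x1 y1]] := rescale x y.
have rx := sqr_selfadjZ (ltW r0) xs; have ry := sqr_selfadjZ (ltW r0) ys.
have r20 : 0 < 2%:R^-1 * r by rewrite mulr_gt0 ?invr_gt0.
rewrite (scalerKR (x + y) r20); apply: sqr_selfadjZ.
  by rewrite invr_ge0 ltW.
rewrite rmorphM/= -scalerA.
apply: sqr_selfadj_of_norm.
  by apply: selfadjZ; apply: selfadjZ; apply: selfadjD;
    exact: sqr_selfadj_selfadj.
move: (sqr_selfadj_norm rx x1) (sqr_selfadj_norm ry y1).
rewrite scalerDr; move: (_ *: x) (_ *: y) => p q p1 q1.
rewrite -[1](scaler_half) -scalerBr opprD addrACA.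
rewrite rnormZR ger0_norm ?invr_ge0//.
by have := rnormD (1 - p) (1 - q); lra.
Qed.

Lemma adjM_eq0 x : adj x * x = 0 -> x = 0.
Proof.
move=> x0; apply: rnorm_eq0; have := rnorm_adjM x; rewrite x0 rnorm0.
by have := rnorm_ge0 x; nra.
Qed.

Lemma addi_eq0 b k : selfadj b -> selfadj k -> b + 'i%C *: k = 0 -> k = 0.
Proof.
move=> bs ks u0; have := adj_subi_mul bs ks; rewrite u0 adj0 subr0.
rewrite -(rmorph_nat (real_complex R)) => /(congr1 (@rnorm R C)).
rewrite rnormZR rnormZi rnorm0 => /eqP; rewrite mulf_eq0 normr_eq0 pnatr_eq0/=.
by move=> /eqP k0; apply: rnorm_eq0; rewrite k0.
Qed.

Lemma rnorm_exp_le1 x n : rnorm x <= 1 -> rnorm (x ^+ n) <= 1.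
Proof.
move=> x1; elim: n => [|n IH]; first exact: rnorm1_le1.
rewrite exprS (le_trans (rnormM _ _))// -[leRHS]mulr1.
by rewrite ler_pM ?rnorm_ge0.
Qed.

(** Norms of powers grow exponentially along the powers of two. *)
Lemma rnorm_le1_growth P : selfadj P ->
  (forall n, rnorm (P ^+ n) <= n.+1%:R) -> rnorm P <= 1.
Proof.
move=> Ps Pn; rewrite leNgt; apply/negP => P1.
have N2 m : rnorm (P ^+ (2 ^ m)) = rnorm P ^+ (2 ^ m).
  elim: m => [|m IH]; first by rewrite !expr1.
  by rewrite expnSr !exprM rnorm_sqr ?IH//; exact: selfadjX.
have bern n : 1 + n%:R * (rnorm P - 1) <= rnorm P ^+ n.
  elim: n => [|n IH]; first by rewrite mul0r addr0 expr0.
  rewrite exprS -natr1; have n0 : (0 : R) <= n%:R by [].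
  have p1 : 1 <= rnorm P ^+ n by rewrite exprn_ege1// ltW.
  by move: (rnorm P) (rnorm P ^+ n) n%:R P1 IH n0 p1 => p q r; nra.
(* For [N = 2 ^ m > 4 / d ^ 2], the square of the Bernoulli bound [1 + N d] is
   larger than the bound [2 N + 1] on the norm of the power [2 N]. *)
pose d := rnorm P - 1; have d0 : 0 < d by rewrite subr_gt0.
pose m := Num.truncn (4%:R / d ^+ 2).
have mE : 4%:R / d ^+ 2 < m.+1%:R by apply: truncnS_gt.
have m2 : (m.+1%:R : R) <= (2 ^ m)%:R by rewrite ler_nat ltn_expl.
have := Pn (2 ^ m.+1)%N; rewrite N2 expnSr exprM -natr1 natrM.
have := bern (2 ^ m)%N; rewrite -/d.
have := lt_le_trans mE m2; rewrite ltr_pdivrMr ?exprn_gt0//.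
have : (1 : R) <= (2 ^ m)%:R by rewrite ler1n expn_gt0.
move: (rnorm P ^+ _) ((2 ^ m)%:R : R) d0 => q N d0 N1 H1 H2 H3.
have H4 : (1 + N * d) ^+ 2 <= q ^+ 2.
  by rewrite ler_pXn2r// nnegrE; nra.
have H5 : 4%:R * N <= N * d ^+ 2 * N by rewrite ler_pM2r ?ltW//; lra.
have : 0 <= N * d by nra.
by move: H4 H5; rewrite !expr2; nra.
Qed.

(** The products [c^* c] and [c c^*] satisfy
    [c^* c (1 - c^* c) ^ n = c^* (1 - c c^* ) ^ n c], which is bounded since
    [c c^*] turns out to be a sum of squares; so the powers of [1 + k ^ 2] grow
    at most linearly, whence [1 + k ^ 2] has norm at most [1]. *)
Lemma adjM_neg_sqr c k : selfadj k -> adj c * c = - k ^+ 2 -> k = 0.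
Proof.
move=> ks; wlog c1 : c k ks / rnorm c <= 1.
  have [r r0 [c1 _]] := rescale c 0 => /(_ (r%:C *: c) (r%:C *: k)) + E.
  move=> /(_ (selfadjZ r ks) c1); rewrite adjZR -cscalerAl -cscalerAr E.
  rewrite !expr2 -cscalerAl -cscalerAr !scalerN => /(_ erefl) rk.
  by rewrite (scalerKR k r0) rk scaler0.
move=> E; pose q := c * adj c.
have qs : sqr_selfadj q.
  (* [c^* c + c c^*] is half the sum of the squares of [a] and [b]. *)
  pose a := c + adj c; pose b := 'i%C *: (c - adj c).
  have -> : q = k ^+ 2 + (2%:R^-1 : R)%:C *: (a ^+ 2 + b ^+ 2).
    apply: (addrI (- k ^+ 2)); rewrite addrA addNr add0r -E -[LHS]scaler_half.
    congr (_ *: _); rewrite /a /b !expr2 -cscalerAl -cscalerAr scaler_ii.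
    rewrite !mulrDl !mulrDr !mulNr !mulrN opprK !opprD !opprK -/q.
    rewrite (addrACA (c * c + q)) (addrACA (c * c)) subrr add0r.
    rewrite [LHS]addrACA (addrACA (adj c * c) (adj c * adj c)) subrr addr0.
    by rewrite addrC -/q E.
  apply: sqr_selfadjD; first by exists k.
  apply: sqr_selfadjZ; first by rewrite invr_ge0.
  apply: sqr_selfadjD; first by exists a => //;
    rewrite /selfadj adjD adjK addrC.
  by exists b => //; rewrite /selfadj adjZi adjB adjK -scalerN opprB.
have q1 : rnorm (1 - q) <= 1.
  apply: sqr_selfadj_norm => //; rewrite (le_trans (rnormM _ _))// rnorm_adj.
  by rewrite -[leRHS]mulr1 ler_pM ?rnorm_ge0.
pose P := 1 - adj c * c.
have cP n : c * P ^+ n = (1 - q) ^+ n * c.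
  elim: n => [|n IH]; first by rewrite mulr1 mul1r.
  rewrite exprSr mulrA IH -mulrA exprSr -mulrA; congr (_ * _).
  by rewrite mulrBr mulrBl mulr1 mul1r mulrA.
have Pn n : rnorm (P ^+ n) <= n.+1%:R.
  elim: n => [|n IH]; first exact: rnorm1_le1.
  have -> : P ^+ n.+1 = P ^+ n - adj c * ((1 - q) ^+ n * c).
    by rewrite exprS {1}/P mulrBl mul1r -cP mulrA.
  rewrite -natr1 (le_trans (rnormB _ _))// lerD//.
  rewrite (le_trans (rnormM _ _))// rnorm_adj -[leRHS]mulr1.
  rewrite ler_pM ?rnorm_ge0// (le_trans (rnormM _ _))// -[leRHS]mulr1.
  by rewrite ler_pM ?rnorm_ge0// rnorm_exp_le1.
have Ps : selfadj P by apply: selfadjB; [exact: selfadj1|exact: selfadj_adjM].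
have hs : selfadj (1 - P) by apply: selfadjB => //; exact: selfadj1.
have := rnorm_le1_growth Ps Pn; rewrite -{1}(subKr 1 P) => P1.
have [b [bE bs _ bc]] := sqrt_exists hs P1.
have bk : b * k = k * b.
  apply/esym/bc; rewrite /P subKr E mulrN mulNr -exprS -exprSr//.
apply: (addi_eq0 bs ks); apply: adjM_eq0.
by rewrite adj_addi_mul// -bE /P subKr E addNr.
Qed.

(** Cut off at the negative part [h_-] of [h = a^* a], the element
    [c = a h_-] has [c^* c = - h_- ^ 3]. *)
Theorem adjM_sqr (a : C) : sqr_selfadj (adj a * a).
Proof.
wlog a1 : a / rnorm a <= 1.
  have [r r0 [a1 _]] := rescale a 0 => /(_ _ a1).
  rewrite adjZR -cscalerAl -cscalerAr scalerA -rmorphM.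
  have rr0 : 0 < r * r by rewrite mulr_gt0.
  move=> H; rewrite (scalerKR (adj a * a) rr0).
  by apply: sqr_selfadjZ; rewrite ?invr_ge0 ?ltW.
pose h := adj a * a; have hs : selfadj h := selfadj_adjM a.
have h1 : rnorm h <= 1 by rewrite rnorm_adjM expr_le1// rnorm_ge0.
have [d [dE ds d1 dc]] := sqrt_exists (selfadjX 2 hs) (rnorm_1Bsqr hs h1).
have [e [eE es _ ec]] := sqrt_exists ds d1.
have hd : h * d = d * h by apply: dc; rewrite -exprS -exprSr.
pose m := d - h; have ms : selfadj m by exact: selfadjB.
have md : m * d = d * m by rewrite mulrBl mulrBr hd.
have me : m * e = e * m by exact: ec.
have mhm : m * h * m = - (m * e) ^+ 2.
  have -> : (m * e) ^+ 2 = m * d * m.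
    by rewrite expr2 -!mulrA (mulrA e m e) -me -mulrA -(expr2 e) -eE md mulrA.
  rewrite -mulNr -mulrN; congr (_ * _).
  by rewrite mulrN /m !mulrBl hd -!expr2 dE opprB.
have mes : selfadj (m * e) by exact: selfadjM.
have me0 : m * e = 0.
  by apply: (@adjM_neg_sqr (a * m)); rewrite // adjM ms -!mulrA -mhm /h !mulrA.
have md0 : m * d = 0 by rewrite eE expr2 mulrA me0 mul0r.
have mh0 : m * h * m = 0 by rewrite mhm me0 expr0n oppr0.
have m3 : m * m * m = 0.
  transitivity (m * d * m - m * h * m); first by rewrite -mulrBl -mulrBr.
  by rewrite md0 mul0r mh0 subrr.
have m0 : m = 0.
  apply: adjM_eq0; rewrite ms; apply: adjM_eq0.
  by rewrite adjM ms mulrA m3 mul0r.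
by rewrite -/h -(subr0_eq m0); exists e.
Qed.

Section RealFunctional.
Variable L : C -> R.
Hypothesis LD : forall x y, L (x + y) = L x + L y.
Hypothesis LZ : forall (r : R) x, L (r%:C *: x) = r * L x.
Hypothesis Lnorm : forall x, L x <= rnorm x.
Hypothesis L1 : L 1 = 1.

Let LN x : L (- x) = - L x.
Proof. by rewrite -scaleN1r -(rmorphN1 (real_complex R)) LZ mulN1r. Qed.

(** The norm of [t + i b] is [t + O(1 / t)] for selfadjoint [b]. *)
Lemma functional_selfadj b : selfadj b -> L ('i%C *: b) = 0.
Proof.
suff H c : selfadj c -> L ('i%C *: c) <= 0.
  move=> bs; apply/eqP; rewrite eq_le H//= -oppr_le0 -LN -scalerN H//.
  exact: selfadjN.
move=> cs; rewrite leNgt; apply/negP => y0.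
have tP t : 0 <= t -> (t + L ('i%C *: c)) ^+ 2 <= t ^+ 2 + rnorm c ^+ 2.
  move=> t0; have t1s : selfadj (t%:C *: (1 : C)) := selfadjZ t selfadj1.
  have tc : t%:C *: (1 : C) * c = c * (t%:C *: (1 : C)).
    by rewrite -cscalerAl -cscalerAr mul1r mulr1.
  have := adj_addi_mul t1s cs tc => /(congr1 (@rnorm R C)); rewrite rnorm_adjM.
  have := rnormD ((t%:C *: (1 : C)) ^+ 2) (c ^+ 2).
  rewrite !rnorm_sqr// rnormZR.
  have := Lnorm (t%:C *: (1 : C) + 'i%C *: c); rewrite LD LZ L1 mulr1.
  rewrite (ger0_norm t0).
  have := rnorm1_le1; have := rnorm_ge0 (1 : C).
  move: (rnorm (_ + 'i%C *: c)) (rnorm (_ + c ^+ 2)) (rnorm (1 : C)) (rnorm c)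
    y0 t0.
  move: (L _) => y p q r s y0 t0' r0 r1 H1 H2 H3.
  have H4 : (t + y) ^+ 2 <= p ^+ 2 by rewrite ler_pXn2r ?nnegrE//; lra.
  have H5 : (t * r) ^+ 2 <= t ^+ 2.
    by rewrite ler_pXn2r ?nnegrE ?mulr_ge0// ler_piMr.
  by lra.
(* For this [t], the inequality [2 t y + y ^ 2 <= |c| ^ 2] with [y = L (i c)]
   reads [2 |c| ^ 2 + 2 + y ^ 2 <= |c| ^ 2]. *)
have := tP ((rnorm c ^+ 2 + 1) / L ('i%C *: c)).
move: (L _) (sqr_ge0 (rnorm c)) y0 => y; move: (rnorm c ^+ 2) => s s0 y0.
have -> : ((s + 1) / y + y) ^+ 2 = ((s + 1) / y) ^+ 2 + 2%:R * (s + 1) + y ^+ 2.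
  by field; rewrite gt_eqF.
have sy0 : 0 <= (s + 1) / y by rewrite divr_ge0 ?addr_ge0// ltW.
by move=> /(_ sy0); have := sqr_ge0 y; lra.
Qed.

(** A positive [x] of norm at most [1] satisfies [|1 - x| <= 1], and then
    [1 - L x <= 1]. *)
Lemma functional_adjM_ge0 (a : C) : 0 <= L (adj a * a).
Proof.
have [r r0 [x1 _]] := rescale (adj a * a) 0.
have xs := sqr_selfadjZ (ltW r0) (adjM_sqr a).
rewrite -(pmulr_rge0 _ r0) -LZ; move: (sqr_selfadj_norm xs x1).
by have := Lnorm (1 - r%:C *: (adj a * a)); rewrite LD LN L1; lra.
Qed.

End RealFunctional.

End CStar.

(** * The Hahn-Banach theorem *)

Section HahnBanach.
Variables (R : realType) (V : normedModType R[i]).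
Implicit Types (G : set (V * R)) (x y : V) (r s t : R).

(** Real-linear subspaces of [V * R] whose elements [(x, r)] satisfy
    [r <= |x|]; these are graphs of functionals. *)
Let dominated_graph G :=
  (forall t x y r s, G (x, r) -> G (y, s) -> G (t%:C *: x + y, t * r + s)) /\
  forall x r, G (x, r) -> r <= rnorm x.

Let addline G x r : set (V * R) :=
  [set w | exists t m s, G (m, s) /\ w = (t%:C *: x + m, t * r + s)].

(** The new value [r] has to lie between the numbers [s - |m - x|] and
    [|m + x| - s], for [(m, s)] in [G]; the triangle inequality leaves room. *)
Let dominated_extend G x : G (0, 0) -> dominated_graph G ->
  exists r, dominated_graph (addline G x r).
Proof.
move=> G0 [Glin Gdom].
have GD m s m' s' : G (m, s) -> G (m', s') -> G (m + m', s + s').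
  by move=> H H'; have := Glin 1 _ _ _ _ H H'; rewrite scale1r mul1r.
have GZ t m s : G (m, s) -> G (t%:C *: m, t * s).
  by move=> H; have := Glin t _ _ _ _ H G0; rewrite !addr0.
pose S := [set z | exists m s, G (m, s) /\ z = s - rnorm (m - x)].
have S0 : S !=set0 by exists (0 - rnorm (0 - x)), 0, 0.
have Sub m s : G (m, s) -> ubound S (rnorm (m + x) - s).
  move=> Gm _ [m' [s' [Gm' ->]]]; have := Gdom _ _ (GD _ _ _ _ Gm Gm').
  have := rnormD (m + x) (m' - x).
  by rewrite addrACA subrr addr0; lra.
have Sb : has_ubound S by exists (rnorm (0 + x) - 0); exact: Sub.
pose r := sup S.
have rub m s : G (m, s) -> r <= rnorm (m + x) - s.
  by move=> Gm; apply: ge_sup => //; exact: Sub.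
have rlb m s : G (m, s) -> s - rnorm (m - x) <= r.
  by move=> Gm; apply: ub_le_sup => //; exists m, s.
exists r; split.
  move=> t _ _ _ _ [t1 [m1 [s1 [G1 [-> ->]]]]] [t2 [m2 [s2 [G2 [-> ->]]]]].
  exists (t * t1 + t2), (t%:C *: m1 + m2), (t * s1 + s2); split;
    first exact: Glin.
  congr pair; last by ring.
  by rewrite scalerDr rmorphD rmorphM/= scalerDl scalerA addrACA.
move=> _ _ [t [m [s [Gm [-> ->]]]]].
have [t0|t0|->] := ltgtP t 0; last first.
- by rewrite scale0r mul0r !add0r Gdom.
- have := rub _ _ (GZ t^-1 _ _ Gm).
  rewrite -(ler_pM2l t0) mulrBr mulrA mulfV ?gt_eqF// mul1r.
  rewrite -{2}(gtr0_norm t0) -rnormZR scalerDr scalerA -rmorphM mulfV ?gt_eqF//.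
  by rewrite scale1r [m + _]addrC; lra.
- have nt0 : 0 < - t by rewrite oppr_gt0.
  have := rlb _ _ (GZ (- t)^-1 _ _ Gm).
  rewrite -(ler_pM2l nt0) mulrBr mulrA mulfV ?gt_eqF// mul1r.
  rewrite -{1}(gtr0_norm nt0) -rnormZR scalerBr scalerA -rmorphM mulfV
    ?gt_eqF//.
  by rewrite scale1r rmorphN scaleNr opprK [m + _]addrC; lra.
Qed.

Theorem hahn_banach (E : set V) (l : V -> R) : E 0 ->
  (forall t x y, E x -> E y -> E (t%:C *: x + y)) ->
  (forall t x y, E x -> E y -> l (t%:C *: x + y) = t * l x + l y) ->
  (forall x, E x -> l x <= rnorm x) ->
  exists L : V -> R, [/\ forall t x y, L (t%:C *: x + y) = t * L x + L y,
    forall x, L x <= rnorm x & forall x, E x -> L x = l x].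
Proof.
move=> E0 Elin llin ldom.
pose G0 : set (V * R) := [set w | E w.1 /\ w.2 = l w.1].
have l0 : l 0 = 0.
  by have := llin (-1) 0 0 E0 E0; rewrite scaler0 addr0 mulN1r addNr.
have G00 : G0 (0, 0) by [].
have G0good : dominated_graph G0.
  split=> [t x y r s [/= Ex ->] [/= Ey ->]|x r [/= Ex ->]]; last exact: ldom.
  by split=> /=; [exact: Elin|rewrite llin].
have [|M [Mgood Mmax]] := @Zorn_bigcup _ [set G | dominated_graph (G0 `|` G)].
  move=> F FP Ftot /=; have [->|/set0P[G1 FG1]] := eqVneq F set0.
    by rewrite bigcup_set0 setU0.
  have join w w' : (G0 `|` \bigcup_(G in F) G) w ->
      (G0 `|` \bigcup_(G in F) G) w' ->
      exists2 G, F G & (G0 `|` G) w /\ (G0 `|` G) w'.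
    move=> [Gw|[G FG Gw]] [Gw'|[G' FG' Gw']].
    - by exists G1 => //; split; left.
    - by exists G' => //; split; [left|right].
    - by exists G => //; split; [right|left].
    - have [GG'|G'G] := Ftot _ _ FG FG'.
        by exists G' => //; split; right => //; exact: GG'.
      by exists G => //; split; right => //; exact: G'G.
  have sub G : F G -> G0 `|` G `<=` G0 `|` \bigcup_(G in F) G.
    by move=> FG w [?|?]; [left|right; exists G].
  split=> [t x y r s wx wy|x r wx].
    have [G FG [Gx Gy]] := join _ _ wx wy.
    by apply: (sub G FG); exact: (FP G FG).1.
  have [G FG [Gx _]] := join _ _ wx wx.
  exact: (FP G FG).2 Gx.
pose T := G0 `|` M; have T00 : T (0, 0) by left.
have Tfull x : exists r, T (x, r).
  have [r Tr] := dominated_extend x T00 Mgood.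
  have TE : T `<=` addline T x r.
    move=> [m s] Tm; exists 0, m, s; split=> //.
    by rewrite scale0r mul0r !add0r.
  exists r; right; suff -> : M = addline T x r.
    by exists 1, 0, 0; split=> //; rewrite scale1r mul1r !addr0.
  apply: contrapT => H; apply: (Mmax (addline T x r)).
    split=> [w Mw|H']; first by apply: TE; right.
    by apply: H; apply/seteqP; split=> // w Mw; apply: TE; right.
  rewrite /= (_ : G0 `|` _ = addline T x r)//; apply/seteqP; split.
    by move=> w [Gw|//]; apply: TE; left.
  by move=> w ?; right.
have Tfun x r s : T (x, r) -> T (x, s) -> r = s.
  move=> Tr Ts; have := Mgood.1 (-1) _ _ _ _ Tr Ts.
  have := Mgood.1 (-1) _ _ _ _ Ts Tr.
  rewrite rmorphN1 scaleN1r addNr !mulN1r.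
  by move=> /(Mgood.2) + /(Mgood.2); rewrite rnorm0; lra.
pose L x := sval (cid (Tfull x));
  have LP x : T (x, L x) := svalP (cid (Tfull x)).
exists L; split=> [t x y|x|x Ex].
- apply: Tfun (LP _) _; exact: (Mgood.1 t x y _ _ (LP x) (LP y)).
- exact: Mgood.2 (LP x).
- by apply: Tfun (LP _) _; left.
Qed.

End HahnBanach.

(** * States *)

Lemma complex_ge0P (R : realType) (z : R[i]) :
  0 <= z <-> complex.Im z = 0 /\ 0 <= complex.Re z.
Proof. by rewrite lecE/=; split=> [/andP[/eqP-> ->]|[-> ->]];
  rewrite ?eqxx. Qed.

Lemma complex_ext (R : realType) (z w : R[i]) :
  complex.Re z = complex.Re w -> complex.Im z = complex.Im w -> z = w.
Proof. by case: z w => [a b] [c d] /= -> ->. Qed.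

Section States.
Variables (R : realType) (A : cstarAlgType R).
Local Notation C := (cring A).
Implicit Types (x y a : C).

Definition state (phi : A -> R[i]) := [/\
  forall (z : R[i]) x y, phi (z *: x + y) = z * phi x + phi y,
  phi cunit = 1 & forall a : C, 0 <= phi (adj a * a)].

Lemma sqr_selfadj_normB (r : R) x : selfadj x -> rnorm x <= r ->
  sqr_selfadj (r%:C *: (1 : C) - x).
Proof.
move=> xs xr; have [r0|r0] := leP r 0.
  rewrite (rnorm_eq0 (le_trans xr r0)) subr0.
  have -> : r = 0 by apply/eqP; rewrite eq_le r0 (le_trans _ xr)// rnorm_ge0.
  by rewrite scale0r; exists 0; [exact: adj0|rewrite expr0n].
have -> : r%:C *: (1 : C) - x = r%:C *: (1 - (r^-1)%:C *: x).
  by rewrite scalerBr scalerA -rmorphM mulfV ?scale1r// gt_eqF.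
apply: sqr_selfadjZ; first exact: ltW.
apply: sqr_selfadj_of_norm.
  by apply: selfadjB; [exact: selfadj1|exact: selfadjZ].
by rewrite subKr rnormZR gtr0_norm ?invr_gt0// mulrC ler_pdivrMr// mul1r.
Qed.

(** Multiplication by [i] turns a real functional into its imaginary part. *)
Lemma state_of_real_functional (L : C -> R) :
  (forall (t : R) x y, L (t%:C *: x + y) = t * L x + L y) ->
  (forall x, L x <= rnorm x) -> L 1 = 1 ->
  state (fun x : C => (L x)%:C - 'i%C * (L ('i%C *: x))%:C).
Proof.
move=> Llin Lnorm L1.
have L0 : L 0 = 0.
  by have := Llin (-1) 0 0; rewrite scaler0 addr0 mulN1r addNr.
have LD x y : L (x + y) = L x + L y.
  by have := Llin 1 x y; rewrite scale1r mul1r.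
have LZ (t : R) x : L (t%:C *: x) = t * L x.
  by have := Llin t x 0; rewrite !addr0 L0 addr0.
have LN x : L (- x) = - L x.
  by rewrite -[in LHS]scaleN1r -(rmorphN1 (real_complex R)) LZ mulN1r.
have Lc (z : R[i]) x :
    L (z *: x) = complex.Re z * L x + complex.Im z * L ('i%C *: x).
  rewrite {1}[z]complexE scalerDl mulrC -scalerA LD !LZ//.
have sa0 := functional_selfadj LD LZ Lnorm L1.
have pos := functional_adjM_ge0 LD LZ Lnorm L1.
split=> [z x y||a].
- rewrite scalerDr scalerA !LD (Lc z x) (Lc ('i%C * z) x).
  by case: z => u v; apply: complex_ext => /=; ring.
- have := sa0 1 (@selfadj1 _ _); rewrite /cunit/= => ->.
  by rewrite mulr0 subr0; congr _%:C.
- by rewrite sa0; [rewrite mulr0 subr0 lecR|exact: selfadj_adjM].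
Qed.

Section StateTheory.
Variable phi : A -> R[i].
Hypothesis phi_state : state phi.

Lemma stateD x y : phi (x + y) = phi x + phi y.
Proof. by have [/(_ 1 x y)] := phi_state; rewrite scale1r mul1r. Qed.

Lemma state0 : phi 0 = 0.
Proof. by apply: (addrI (phi 0)); rewrite -stateD !addr0. Qed.

Lemma stateZ (z : R[i]) x : phi (z *: x) = z * phi x.
Proof. by have [/(_ z x 0)] := phi_state; rewrite !addr0 state0 addr0. Qed.

Lemma stateN x : phi (- x) = - phi x.
Proof. by rewrite -[in LHS]scaleN1r stateZ mulN1r. Qed.

Lemma stateB x y : phi (x - y) = phi x - phi y.
Proof. by rewrite stateD stateN. Qed.

Lemma state1 : phi (1 : C) = 1.
Proof. by have [] := phi_state. Qed.

Lemma state_sum (n : nat) (f : 'I_n -> A) : phi (\sum_i f i) = \sum_i phi (f i).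
Proof. exact: (big_morph phi stateD state0). Qed.

Lemma state_adjM_ge0 x : 0 <= phi (adj x * x).
Proof. by have [] := phi_state. Qed.

Lemma state_sqr_ge0 x : sqr_selfadj x -> 0 <= phi x.
Proof. by move=> [b bs ->]; have := state_adjM_ge0 b; rewrite bs. Qed.

Lemma state_selfadj_Im x : selfadj x -> complex.Im (phi x) = 0.
Proof.
move=> xs; have /state_sqr_ge0 := sqr_selfadj_normB xs (lexx _).
rewrite stateB stateZ state1 mulr1 => /complex_ge0P[/= + _].
by case: (phi x) => u v /=; lra.
Qed.

Lemma state_adj x : phi (adj x) = (phi x)^*%C.
Proof.
have s1 : selfadj (x + adj x) by rewrite /selfadj adjD adjK addrC.
have s2 : selfadj ('i%C *: (x - adj x)).
  by rewrite /selfadj adjZi adjB adjK -scalerN opprB.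
have := state_selfadj_Im s2; have := state_selfadj_Im s1.
rewrite stateD stateZ stateB.
case: (phi x) (phi (adj x)) => [a b] [c d] /= H1 H2.
by apply: complex_ext => /=; lra.
Qed.

(** The Cauchy-Schwarz inequality, from positivity at [x - phi x]. *)
Lemma state_sqr_le x : (phi x)^*%C * phi x <= phi (adj x * x).
Proof.
have := state_adjM_ge0 (x - phi x *: (1 : C)).
rewrite adjB adjZ adj1 mulrBl !mulrBr -!cscalerAl -!cscalerAr mul1r !mulr1.
rewrite !(stateD, stateN, stateZ, state1, state_adj) => pos.
by rewrite -subr_ge0; move: pos; congr (_ <= _); ring.
Qed.

Lemma state_norm_le x : complex.Re `|phi x| <= rnorm x.
Proof.
have h : rnorm (adj x * x) <= rnorm x ^+ 2 by rewrite rnorm_adjM.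
have /state_sqr_ge0 := sqr_selfadj_normB (selfadj_adjM x) h.
rewrite stateB stateZ state1 mulr1 subr_ge0 => /(le_trans (state_sqr_le x)).
rewrite (_ : _ * _ = (complex.Re `|phi x| ^+ 2)%:C) ?lecR; last first.
  by rewrite rmorphXn/= Re_norm normCK mulrC.
by rewrite ler_pXn2r// nnegrE ?rnorm_ge0 ?Re_norm_ge0.
Qed.

End StateTheory.

(** The real part of [phi] is dominated by the norm, and determines [phi]. *)
Lemma state_of_contraction (phi : A -> R[i]) :
  (forall (z : R[i]) x y, phi (z *: x + y) = z * phi x + phi y) ->
  phi cunit = 1 -> (forall x : C, complex.Re `|phi x| <= rnorm x) -> state phi.
Proof.
move=> lin phi1 phin.
have phi0 : phi 0 = 0.
  by have := lin (-1) 0 0; rewrite scaler0 addr0 mulN1r addNr.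
have phiZ (z : R[i]) (x : C) : phi (z *: x) = z * phi x.
  by have := lin z x 0; rewrite !addr0 phi0 addr0.
pose L (x : C) := complex.Re (phi x).
have [|||lin' one pos] := @state_of_real_functional L.
- move=> t x y; rewrite /L lin//=; case: (phi x) (phi y) => [a b] [c d] /=.
  by ring.
- by move=> x; apply: le_trans (ler_norm _) _;
  exact: le_trans (norm_Re _) (phin x).
- by rewrite /L; have -> : phi (1 : C) = 1 by [].
- split=> // a; have := pos a; rewrite /L phiZ; congr (_ <= _).
  by case: (phi _) => u v; apply: complex_ext => /=; ring.
Qed.

(** A positive functional on an operator system is dominated by the norm, as
    [|x| - x] is positive for selfadjoint [x]; by Hahn-Banach its real part
    extends, and a unital functional dominated by the norm is positive. *)
Theorem state_extension (E : set A) (phi : A -> R[i]) : operator_system E ->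
  (forall (z : R[i]) x y, E x -> E y -> phi (z *: x + y) = z * phi x + phi y) ->
  phi cunit = 1 ->
  (forall a : C, E (adj a * a) -> 0 <= phi (adj a * a)) ->
  exists2 psi, state psi & forall x, E x -> psi x = phi x.
Proof.
move=> [E1 Elin Estar] lin phi1 pos.
have E0 : E 0 by have := Elin (-1) _ _ E1 E1; rewrite scaleN1r addNr.
have phi0 : phi 0 = 0.
  by have := lin (-1) 0 0 E0 E0; rewrite scaler0 addr0 mulN1r addNr.
have EZ (z : R[i]) (x : C) : E x -> E (z *: x).
  by move=> Ex; have := Elin z _ _ Ex E0; rewrite addr0.
have ED (x y : C) : E x -> E y -> E (x + y).
  by move=> Ex Ey; have := Elin 1 _ _ Ex Ey; rewrite scale1r.
have EB (x y : C) : E x -> E y -> E (x - y).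
  by move=> Ex Ey; apply: ED => //; rewrite -scaleN1r; exact: EZ.
have phiZ (z : R[i]) (x : C) : E x -> phi (z *: x) = z * phi x.
  by move=> Ex; have := lin z x 0 Ex E0; rewrite !addr0 phi0 addr0.
have phiD (x y : C) : E x -> E y -> phi (x + y) = phi x + phi y.
  by move=> Ex Ey; have := lin 1 x y Ex Ey; rewrite scale1r mul1r.
have phiB (x y : C) : E x -> E y -> phi (x - y) = phi x - phi y.
  move=> Ex Ey; rewrite phiD//; last by rewrite -scaleN1r; exact: EZ.
  by rewrite -[in LHS](scaleN1r y) phiZ// mulN1r.
have dom (x : C) : E x -> selfadj x -> phi x <= (rnorm x)%:C.
  move=> Ex xs; have [b bs bE] := sqr_selfadj_normB xs (lexx _).
  have Eb : E ((rnorm x)%:C *: (1 : C) - x) by apply: EB => //; exact: EZ.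
  have := pos b; rewrite bs -expr2 -bE => /(_ Eb).
  by rewrite phiB//; last exact: EZ; rewrite phiZ// phi1 mulr1 subr_ge0.
have sa_Im (x : C) : E x -> selfadj x -> complex.Im (phi x) = 0.
  by move=> Ex xs; have := dom x Ex xs; rewrite lecE/= => /andP[/eqP].
pose l (x : C) := complex.Re (phi x).
have [||||L [Llin Lnorm LE]] := @hahn_banach R C E l.
- exact: E0.
- by move=> t x y; exact: Elin.
- move=> t x y Ex Ey; rewrite /l lin//; case: (phi x) (phi y) => [a b] [c d] /=.
  by ring.
- move=> x Ex; have Es : E (adj x) by exact: Estar.
  have s1 : selfadj (x + adj x) by rewrite /selfadj adjD adjK addrC.
  have s2 : selfadj ('i%C *: (x - adj x)).
    by rewrite /selfadj adjZi adjB adjK -scalerN opprB.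
  have := sa_Im _ (EZ 'i%C _ (EB _ _ Ex Es)) s2.
  have := dom _ (ED _ _ Ex Es) s1.
  rewrite phiD// phiZ ?phiB//; last exact: EB.
  rewrite lecE => /andP[_]; have := rnormD x (adj x); rewrite rnorm_adj /l.
  case: (phi x) (phi (adj x)) => [a b] [c d] /=.
  by lra.
have L1 : L 1 = 1 by rewrite LE// /l phi1.
exists (fun x : C => (L x)%:C - 'i%C * (L ('i%C *: x))%:C).
  exact: state_of_real_functional.
move=> x Ex; rewrite !LE//; last exact: EZ.
rewrite /l phiZ//; case: (phi x) => u v; apply: complex_ext => /=; ring.
Qed.

End States.

(** * Positive matrices over an algebra of continuous functions *)

Section ScalarIteration.
Variable R : realType.

Fixpoint real_sqrt_iter (x : R) n : R :=
  if n is n'.+1 then (x + real_sqrt_iter x n' ^+ 2) / 2%:R else 0.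

Lemma real_sqrt_iter_dist d n : 0 <= d <= 1 ->
  `|1 - Num.sqrt d - real_sqrt_iter (1 - d) n| <= sqrt_err R n.
Proof.
move=> /andP[d0 d1]; have s0 := sqrtr_ge0 d; have sE := sqr_sqrtr d0.
have s1 : Num.sqrt d <= 1 by rewrite -(sqrtr1 R) ler_wsqrtr.
suff /and3P[y0 y1 ye] : [&& 0 <= real_sqrt_iter (1 - d) n,
    real_sqrt_iter (1 - d) n <= 1 - Num.sqrt d &
    1 - Num.sqrt d - real_sqrt_iter (1 - d) n <= sqrt_err R n].
  by rewrite ger0_norm// subr_ge0.
move: (Num.sqrt d) s0 s1 sE => s s0 s1 <- {d0 d1}.
elim: n => [|n /and3P[y0 y1 ye]] /=; first by rewrite lexx/=; lra.
have := sqrt_err_ge0 R n; have := sqrt_err_le1 R n.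
move: (real_sqrt_iter _ n) (sqrt_err R n) y0 y1 ye => y e y0 y1 ye e1 e0.
apply/and3P; split; first by nra.
- by nra.
- have : (1 - s - y) * (1 - s + y) <= e * (2%:R - e).
    have [yl|yl] := leP (1 - s + y) (2%:R - e).
      by apply: ler_pM; lra.
    by nra.
  by nra.
Qed.

End ScalarIteration.

Section MatrixSquareRoot.
Variable R : realType.
Local Notation K := R[i].
Local Open Scope sesquilinear_scope.

(** For [X = 1 - H] the iterates tend to [1] minus the square root of [H]; they
    are polynomials in [X], hence depend continuously on [X]. *)
Fixpoint mx_sqrt_iter n (X : 'M[K]_n) m : 'M[K]_n :=
  if m is m'.+1 then
    (2%:R^-1 : R)%:C *: (X + mx_sqrt_iter X m' *m mx_sqrt_iter X m')
  else 0.

Section SpectralCalculus.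
Variables (n : nat) (P Q : 'M[K]_n).
Hypotheses (PQ : P *m Q = 1%:M) (QP : Q *m P = 1%:M).
Hypothesis QE : forall i j, Q i j = (P j i)^*%C.

(** The functional calculus of a hermitian matrix with eigenvectors the rows of
    the unitary matrix [P], whose adjoint is [Q]. *)
Definition spectral_calculus (d : 'I_n -> R) : 'M[K]_n :=
  Q *m diag_mx (\row_k (d k)%:C) *m P.
Local Notation fc := spectral_calculus.

Lemma spectral_calculusM d e : fc d *m fc e = fc (fun k => d k * e k).
Proof.
rewrite /fc !mulmxA -(mulmxA _ P Q) PQ mulmx1; congr (_ *m _).
rewrite -mulmxA mulmx_diag; congr (_ *m diag_mx _).
by apply/rowP => k; rewrite !mxE rmorphM.
Qed.

Lemma spectral_calculusD d e : fc d + fc e = fc (fun k => d k + e k).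
Proof.
rewrite /fc -mulmxDl -mulmxDr -raddfD/=; congr (_ *m diag_mx _ *m _).
by apply/rowP => k; rewrite !mxE rmorphD.
Qed.

Lemma spectral_calculusZ (r : R) d : r%:C *: fc d = fc (fun k => r * d k).
Proof.
rewrite /fc scalemxAl scalemxAr -linearZ/=; congr (_ *m diag_mx _ *m _).
by apply/rowP => k; rewrite !mxE rmorphM.
Qed.

Lemma spectral_calculusN d : - fc d = fc (fun k => - d k).
Proof.
rewrite -scaleN1r -(rmorphN1 (real_complex R)) spectral_calculusZ.
by congr fc; apply/funext => k; rewrite mulN1r.
Qed.

Lemma spectral_calculus1 : fc (fun=> 1) = 1%:M.
Proof.
rewrite /fc (_ : \row_k _ = const_mx 1) ?diag_const_mx ?mulmx1//.
by apply/rowP => k; rewrite !mxE.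
Qed.

Lemma spectral_calculus0 : fc (fun=> 0) = 0.
Proof.
have := spectral_calculusZ 0 (fun=> 1); rewrite scale0r => ->.
by congr fc; apply/funext => k; rewrite mul0r.
Qed.

Lemma spectral_calculusE d i j :
  fc d i j = \sum_k (P k i)^*%C * (d k)%:C * P k j.
Proof.
rewrite /fc mxE; apply: eq_bigr => k _; congr (_ * _).
by rewrite mul_mx_diag !mxE QE.
Qed.

Lemma spectral_calculus_herm d i j : (fc d j i)^*%C = fc d i j.
Proof.
rewrite !spectral_calculusE rmorph_sum; apply: eq_bigr => k _.
case: (P k j) (P k i) => [a b] [a' b']; apply: complex_ext => /=; ring.
Qed.

Lemma spectral_calculus_entry (d : 'I_n -> R) (e : R) i j :
  (forall k, `|d k| <= e) -> `|fc d i j| <= n%:R * e%:C.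
Proof.
move=> de; have P1 k l : `|P k l| <= 1.
  have /matrixP/(_ k k) := PQ; rewrite !mxE eqxx (bigD1 l)//= QE => PE.
  rewrite -(@expr_le1 _ 2)// normCK -[leRHS]PE lerDl sumr_ge0// => m _.
  by rewrite QE; exact: mul_conjC_ge0.
rewrite spectral_calculusE (le_trans (ler_norm_sum _ _ _))//.
rewrite mulr_natl -[in leRHS](card_ord n) -sumr_const ler_sum// => k _.
rewrite !normrM norm_conjC norm_real -[leRHS]mulr1 ler_pM ?mulr_ge0//.
  by rewrite lecR.
by rewrite -[leRHS]mul1r ler_pM// lecR.
Qed.

Variable d : 'I_n -> R.
Hypothesis d01 : forall k, 0 <= d k <= 1.

Lemma mx_sqrt_iterE m :
  mx_sqrt_iter (1%:M - fc d) m = fc (fun k => real_sqrt_iter (1 - d k) m).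
Proof.
elim: m => [|m IH] /=; first by rewrite spectral_calculus0.
rewrite IH -spectral_calculus1 spectral_calculusN.
rewrite spectral_calculusM !spectral_calculusD spectral_calculusZ.
by congr fc; apply/funext => k; rewrite mulrC expr2.
Qed.

Definition mx_sqrt := fc (fun k => Num.sqrt (d k)).

Lemma mx_sqrtK : mx_sqrt *m mx_sqrt = fc d.
Proof.
rewrite spectral_calculusM.
by congr fc; apply/funext => k; rewrite -expr2 sqr_sqrtr//; case/andP: (d01 k).
Qed.

(** The rate of convergence does not depend on the matrix. *)
Lemma mx_sqrt_iter_dist m i j :
  `|(1%:M - mx_sqrt) i j - mx_sqrt_iter (1%:M - fc d) m i j|
    <= n%:R * (sqrt_err R m)%:C.
Proof.
rewrite mx_sqrt_iterE -spectral_calculus1.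
have -> : (fc (fun=> 1) - mx_sqrt) i j -
    fc (fun k => real_sqrt_iter (1 - d k) m) i j =
    fc (fun k => 1 - Num.sqrt (d k) - real_sqrt_iter (1 - d k) m) i j.
  transitivity ((fc (fun=> 1) - mx_sqrt -
    fc (fun k => real_sqrt_iter (1 - d k) m)) i j).
    by rewrite [in RHS]mxE [(- fc _) i j]mxE.
  by rewrite /mx_sqrt !spectral_calculusN !spectral_calculusD.
by apply: spectral_calculus_entry => k; exact: real_sqrt_iter_dist.
Qed.

End SpectralCalculus.

Definition psd_form n (H : 'M[K]_n) :=
  forall v : 'I_n -> K, 0 <= \sum_i \sum_j (v i)^*%C * H i j * v j.

Lemma psd_spectral n (H : 'M[K]_n) : (forall i j, (H j i)^*%C = H i j) ->
  psd_form H -> \tr H <= 1 ->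
  exists P Q (d : 'I_n -> R), [/\ P *m Q = 1%:M, Q *m P = 1%:M,
    forall i j, Q i j = (P j i)^*%C, forall k, 0 <= d k <= 1
    & H = spectral_calculus P Q d].
Proof.
move=> Hherm Hpsd Htr; pose P := spectralmx H; pose Q := invmx P.
have Pu : P \in unitmx := spectral_unit H.
have PQ : P *m Q = 1%:M := mulmxV Pu.
have QP : Q *m P = 1%:M := mulVmx Pu.
have QE i j : Q i j = (P j i)^*%C.
  by rewrite /Q invmx_unitary ?spectral_unitarymx// !mxE.
have Hsym : H \is hermsymmx.
  apply/is_hermitianmxP; rewrite expr0 scale1r; apply/matrixP => i j.
  by rewrite !mxE -[LHS]Hherm.
pose d k : R := complex.Re (spectral_diag H 0 k).
have HE : H = spectral_calculus P Q d.
  have /orthomx_spectralP HE := hermitian_normalmx Hsym.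
  rewrite [LHS]HE /spectral_calculus; congr (_ *m diag_mx _ *m _).
  apply/rowP => k; rewrite !mxE RRe_real//.
  by have /mxOverP/(_ 0 k) := hermitian_spectral_diag_real Hsym.
clearbody d; clearbody Q; clearbody P => {Hsym}.
have d0 k : 0 <= d k.
  have := Hpsd (fun i => Q i k); rewrite (_ : (\sum_i _) = (d k)%:C) ?lecR//.
  have -> : (d k)%:C = (P *m H *m Q) k k.
    rewrite HE /spectral_calculus !mulmxA PQ mul1mx -mulmxA PQ mulmx1.
    by rewrite !mxE eqxx mulr1n.
  rewrite mxE exchange_big; apply: eq_bigr => j _ /=.
  rewrite mxE big_distrl; apply: eq_bigr => i _ /=.
  by rewrite QE conjcK.
exists P, Q, d; split=> // k; rewrite d0/= -lecR (le_trans _ Htr)// HE.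
rewrite /spectral_calculus mxtrace_mulC mulmxA PQ mul1mx mxtrace_diag.
rewrite (bigD1 k)//= mxE lerDl.
by apply: sumr_ge0 => l _; rewrite mxE lecR.
Qed.

End MatrixSquareRoot.

Section ContinuousMatrices.
Variables (R : realType) (Z : topologicalType) (cZ : compact [set: Z]).
Local Notation CZ := (cfun R cZ).

Lemma continuous_sum (J : Type) (r : seq J) (F : J -> Z -> R[i]^o) :
  (forall k, continuous (F k)) -> continuous (fun z => \sum_(k <- r) F k z).
Proof.
move=> Fc; elim: r => [|k r IH].
  rewrite (_ : (fun _ => _) = fun=> 0); first by move=> z; exact: cvg_cst.
  by apply/funext => z; rewrite big_nil.
rewrite (_ : (fun _ => _) = fun z => F k z + \sum_(l <- r) F l z).
  by move=> z; apply: cvgD; [exact: Fc|exact: IH].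
by apply/funext => z; rewrite big_cons.
Qed.

Lemma mx_sqrt_iter_continuous n (X : Z -> 'M[R[i]]_n) m i j :
  (forall i j, continuous (fun z => X z i j : R[i]^o)) ->
  continuous (fun z => mx_sqrt_iter (X z) m i j : R[i]^o).
Proof.
move=> Xc; elim: m i j => [|m IH] i j /=.
  rewrite (_ : (fun _ => _) = fun=> 0); first by move=> z; exact: cvg_cst.
  by apply/funext => z; rewrite mxE.
rewrite (_ : (fun _ => _) = fun z => (2%:R^-1 : R)%:C *: (X z i j +
    \sum_k mx_sqrt_iter (X z) m i k * mx_sqrt_iter (X z) m k j : R[i]^o)).
  move=> z; apply: cvgZr; apply: cvgD; first exact: Xc.
  by apply: continuous_sum => k w; apply: cvgM; exact: IH.
by apply/funext => z; rewrite !mxE.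
Qed.

Lemma uniform_limit_continuous (f : Z -> R[i]^o) (g : nat -> Z -> R[i]^o)
    (k : nat) : (forall m, continuous (g m)) ->
  (forall m z, `|f z - g m z| <= k%:R * (sqrt_err R m)%:C) -> continuous f.
Proof.
move=> gc fg z; apply/cvgrPdist_lt => _ /complex_gt0E[e e0 ->].
have k0 : 0 < e / (3%:R * k.+1%:R) by rewrite divr_gt0// mulr_gt0// ltr0n.
have [m me] := sqrt_err_cvg0 k0.
have e3 : 0 < (e / 3%:R)%:C by rewrite ltcR divr_gt0.
have fg3 w : `|f w - g m w| < (e / 3%:R)%:C.
  apply: le_lt_trans (fg m w) _;
    rewrite -(rmorph_nat (real_complex R)) -rmorphM ltcR.
  rewrite (@le_lt_trans _ _ (k.+1%:R * sqrt_err R m))//.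
    by rewrite ler_wpM2r ?sqrt_err_ge0// ler_nat.
  by rewrite mulrC -ltr_pdivlMr ?ltr0n// -mulrA -invfM.
have /cvgrPdist_lt/(_ _ e3) := gc m z.
apply: filterS => w gzw.
have -> : f z - f w = (f z - g m z) + ((g m z - g m w) + (g m w - f w)).
  by rewrite !addrA !subrK.
have -> : e%:C = (e / 3%:R)%:C + ((e / 3%:R)%:C + (e / 3%:R)%:C).
  by rewrite -!rmorphD/=; congr _%:C; field.
rewrite (le_lt_trans (ler_normD _ _))// ltrD//.
by rewrite (le_lt_trans (ler_normD _ _))// ltrD// distrC.
Qed.

Lemma cf_sumE (J : Type) (r : seq J) (F : J -> CZ) z :
  (\sum_(k <- r) F k) z = \sum_(k <- r) F k z.
Proof. exact: (big_morph (fun f : CZ => f z)). Qed.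

(** After rescaling, the pointwise positive square root is a uniform limit of
    polynomials in [M], hence continuous. *)
Theorem psdmx_pointwise n (M : 'M[CZ]_n) : (forall i j, star (M j i) = M i j) ->
  (forall z (v : 'I_n -> R[i]),
    0 <= \sum_i \sum_j (v i)^*%C * M i j z * v j) -> psdmx M.
Proof.
move=> Mherm Mpsd.
(* Division by [T] makes the trace, and hence all eigenvalues, at most [1]. *)
pose T : R := 1 + \sum_i rnorm (M i i).
have T0 : 0 < T by rewrite ltr_pwDl// sumr_ge0// => i _; exact: rnorm_ge0.
pose H z : 'M[R[i]]_n := \matrix_(i, j) ((T^-1)%:C * M i j z).
have Hherm z i j : (H z j i)^*%C = H z i j.
  by rewrite !mxE -[M i j]Mherm rmorphM; congr (_ * _); exact: conjc_real.
have Hpsd z : psd_form (H z).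
  move=> v; have Ti : 0 <= (T^-1)%:C by rewrite lecR invr_ge0 ltW.
  rewrite (_ : \sum_i _ = (T^-1)%:C * \sum_i \sum_j (v i)^*%C * M i j z * v j).
    by rewrite mulr_ge0.
  rewrite big_distrr; apply: eq_bigr => i _; rewrite big_distrr;
    apply: eq_bigr => j _ /=.
  by rewrite mxE mulrCA !mulrA.
have Htr z : \tr (H z) <= 1.
  have tr0 i : 0 <= M i i z.
    have := Mpsd z (fun k => (k == i)%:R).
    rewrite (bigD1 i)//= (bigD1 i)//= eqxx big1 => [|k /negPf ki]; last first.
      by rewrite ki mulr0.
    rewrite [X in _ + X]big1 => [|k /negPf ki]; last first.
      by apply: big1 => l _; rewrite ki rmorph0 !mul0r.
    by rewrite rmorph1 mul1r mulr1 !addr0.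
  rewrite /mxtrace (eq_bigr (fun i => (T^-1)%:C * M i i z)); last by move=> i;
    rewrite mxE.
  rewrite -big_distrr/= -(@ler_pM2l _ T%:C) ?ltcR// mulrA -rmorphM.
  rewrite mulfV ?gt_eqF// mul1r mulr1 rmorphD rmorph_sum -[leLHS]add0r lerD
    ?lecR//.
  by apply: ler_sum => i _;
    rewrite -[leLHS]ger0_norm// (le_trans (norm_cf_le _ _))// rnormE.
have /boolp.choice[S SP] : forall z, exists S : 'M[R[i]]_n, [/\ S *m S = H z,
    forall i j, (S j i)^*%C = S i j & forall m i j,
    `|(1%:M - S) i j - mx_sqrt_iter (1%:M - H z) m i j| <= n%:R * (sqrt_err R
      m)%:C].
  move=> z.
  have [P [Q [d [PQ QP QE d01 HE]]]] := psd_spectral (Hherm z) (Hpsd z) (Htr z).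
  exists (mx_sqrt P Q d); rewrite HE; split=> [|i j|m i j].
  - exact: mx_sqrtK.
  - exact: spectral_calculus_herm.
  - exact: mx_sqrt_iter_dist.
have Sc i j : continuous (fun z => S z i j : R[i]^o).
  have c1 : continuous (fun z => (1%:M - S z) i j : R[i]^o).
    apply: (@uniform_limit_continuous _ (fun m z =>
      mx_sqrt_iter (1%:M - H z) m i j) n).
      move=> m; apply: mx_sqrt_iter_continuous => k l z.
      rewrite (_ : (fun _ => _) = fun z => (k == l)%:R - (T^-1)%:C *: (M k l z
        : R[i]^o)).
        by apply: cvgB; [exact: cvg_cst|apply: cvgZr; exact: cf_cts].
      by apply/funext => w; rewrite !mxE.
    by move=> m z; have [] := SP z.
  rewrite (_ : (fun _ => _) = fun z => (i == j)%:R - (1%:M - S z) i j : R[i]^o).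
    by move=> z; apply: cvgB; [exact: cvg_cst|exact: c1].
  by apply/funext => z; rewrite !mxE opprB addrCA subrr addr0.
exists (\matrix_(i, j) ((Num.sqrt T)%:C *: mkcf cZ (Sc i j))) => i j.
apply: cfP => z; have [SS Sherm _] := SP z.
apply: etrans (esym (cf_sumE _ _ _)).
rewrite [LHS](_ : _ = T%:C * H z i j); last first.
  by rewrite mxE mulrA -rmorphM mulfV ?mul1r// gt_eqF.
rewrite -SS mxE big_distrr; apply: eq_bigr => k _; rewrite !mxE.
rewrite [RHS](_ : _ = ((Num.sqrt T)%:C * S z k i)^*%C * ((Num.sqrt T)%:C * S z
  k j))//.
rewrite -[S z i k]Sherm rmorphM mulrACA; congr (_ * _).
rewrite -[in LHS](sqr_sqrtr (ltW T0)); apply: complex_ext => /=; ring.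
Qed.

End ContinuousMatrices.

(** * The space of ultrafilters on a set *)

(** The Stone-Cech compactification of the discrete space [S]. *)
Definition beta (S : Type) := {U : set_system S | UltraFilter U}.

Section Beta.
Variable S : Type.
Implicit Types (u v : beta S) (A B : set S).

HB.instance Definition _ := gen_eqMixin (beta S).
HB.instance Definition _ := gen_choiceMixin (beta S).

Definition ultra u : set_system S := sval u.

Lemma ultraP u : UltraFilter (ultra u). Proof. exact: svalP u. Qed.

Definition beta_nbhs u : set_system (beta S) :=
  [set V | exists2 A, ultra u A & [set v | ultra v A] `<=` V].

HB.instance Definition _ := hasNbhs.Build (beta S) beta_nbhs.

Lemma ultra_filter u : ProperFilter (ultra u).
Proof. exact: @ultra_proper _ _ (ultraP u). Qed.

Lemma beta_nbhs_filter u : ProperFilter (nbhs u).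
Proof.
have uF := ultra_filter u; split=> [[A uA /(_ u uA)]//|]; split.
- by exists setT => //; exact: filterT.
- move=> V W [A uA AV] [B uB BW]; exists (A `&` B); first exact: filterI.
  move=> v vAB; have vF := ultra_filter v.
  by split; [apply: AV|apply: BW]; apply: filterS vAB => s [].
- by move=> V W VW [A uA AV]; exists A => //; exact: subset_trans VW.
Qed.

Lemma beta_nbhs_singleton u (V : set (beta S)) : nbhs u V -> V u.
Proof. by move=> [A uA]; apply. Qed.

Lemma beta_nbhs_nbhs u (V : set (beta S)) : nbhs u V -> nbhs u (nbhs^~ V).
Proof. by move=> [A uA AV]; exists A => // v vA; exists A. Qed.

HB.instance Definition _ := Nbhs_isNbhsTopological.Build (beta S)
  beta_nbhs_filter beta_nbhs_singleton beta_nbhs_nbhs.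

Lemma ultra_setC u A : ~ ultra u A -> ultra u (~` A).
Proof. by have [] := in_ultra_setVsetC A (ultraP u). Qed.

Lemma ultra_meet u A B : ultra u A -> ultra u B -> A `&` B !=set0.
Proof.
by move=> uA uB; apply: (@filter_ex _ _ (ultra_filter u));
  have uF := ultra_filter u; exact: filterI.
Qed.

Lemma ultra_inj u v : ultra u `<=` ultra v -> u = v.
Proof.
case: u v => [U UU] [V VV]; rewrite /ultra/= => UV.
have E : V = U := @max_filter _ _ UU _ (@ultra_proper _ _ VV) UV.
by move: VV UV; rewrite E => VV _; congr exist; exact: Prop_irrelevance.
Qed.

Lemma beta_hausdorff : hausdorff_space (beta S).
Proof.
move=> u v uv; apply: ultra_inj => A uA; apply: contrapT => /ultra_setC vA.
have [||w [/= wA wA']] := uv [set w | ultra w A] [set w | ultra w (~` A)].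
- by exists A.
- by exists (~` A).
by have [s []] := ultra_meet wA wA'.
Qed.

Lemma beta_compact : compact [set: beta S].
Proof.
rewrite compact_ultra => F FF _; pose U := [set A | F [set u | ultra u A]].
have FF' := @ultra_proper _ _ FF.
have UF : ProperFilter U.
  split=> [U0|].
    have [u] := @filter_ex _ F FF' _ U0.
    by have uF := ultra_filter u; exact: filter_not_empty.
  split=> [|A B UA UB|A B AB UA].
  - apply: (@filterS _ F _ setT _ _ filterT) => u _.
    by have uF := ultra_filter u; exact: filterT.
  - apply: (@filterS _ F _ _ _ _ (@filterI _ F _ _ _ UA UB)) => u [uA uB].
    by have uF := ultra_filter u; exact: filterI.
  - apply: (@filterS _ F _ _ _ _ UA) => u.
    by have uF := ultra_filter u; exact: filterS.
have UU : UltraFilter U.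
  split=> // G GF UG; apply/seteqP; split=> // A GA.
  have [//|FnA] := in_ultra_setVsetC [set u | ultra u A] FF.
  have : U (~` A) by apply: filterS FnA => u; exact: ultra_setC.
  by move=> /UG/(filterI GA)/filter_ex[s []].
exists (exist _ U UU); split=> // V [A UA AV].
exact: filterS AV UA.
Qed.

Definition principal (s : S) : beta S := exist _ _ (principal_filter_ultra s).

(** The extension is the limit along the ultrafilters, which exists by
    compactness and is continuous by regularity. *)
Lemma beta_extension (T : topologicalType) (C : set T) (h : S -> T) :
  regular_space T -> compact C -> (forall s, C (h s)) ->
  exists g : beta S -> T, [/\ continuous g, forall u, C (g u)
    & forall u, h @ ultra u --> g u].
Proof.
move=> regT cC Ch.
have lim u : exists l, C l /\ h @ ultra u --> l.
  have uU := ultraP u; have uF := ultra_filter u.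
  have hU : UltraFilter (h @ ultra u).
    split=> [|G GF hG]; first exact: fmap_proper_filter.
    apply/seteqP; split=> // A GA; apply: contrapT => nA.
    have /hG : (h @ ultra u) (~` A) by exact: ultra_setC nA.
    by move=> /(filterI GA)/filter_ex[s []].
  have [|l [Cl lP]] := (eq_ind _ (fun P => P C) cC _ (@compact_ultra T)) _ hU.
    by apply: filterS (@filterT _ _ uF) => s _; exact: Ch.
  by exists l.
have [g gP] := boolp.choice lim; exists g; split=> [u O Ou|u|u];
  try by case: (gP u).
have [V Vu VO] := regT (g u) O Ou.
have uV : ultra u (h @^-1` V) by case: (gP u) => _; exact.
exists (h @^-1` V) => // v vV; apply: VO => W Wv.
have [_ /(_ _ Wv) vW] := gP v.
by have [s [Vs Ws]] := ultra_meet vV vW; exists (h s).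
Qed.

End Beta.

(** * Minimal closed sets with full image *)

Section Covers.
Variables (X Y : topologicalType) (j : Y -> X).
Hypotheses (hX : hausdorff_space X) (cY : compact [set: Y]) (cj : continuous j).

Lemma closed_fiber x : closed (j @^-1` [set x]).
Proof.
apply: closed_comp => [y _|]; first exact: cj.
exact: accessible_closed_set1 (hausdorff_accessible hX) x.
Qed.

(** By compactness of the fibres, the intersection of a chain of closed sets
    with full image has full image. *)
Lemma minimal_cover_exists (L : set Y) : covering_closed_set j L ->
  exists2 K, minimal_covering_closed_set j K & K `<=` L.
Proof.
move=> [Lcl Lcov].
have [|U [UP Umax]] := @Zorn_bigcup _ [set U | covering_closed_set j (L `\` U)].
  move=> F FP Ftot; have [->|/set0P[U0 FU0]] := eqVneq F set0.
    by rewrite /= bigcup_set0 setD0.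
  split.
    rewrite (_ : _ `\` _ = \bigcap_(U in F) (L `\` U)).
      by apply: closed_bigI => U /FP[].
    apply/seteqP; split=> y; first by move=> [Ly nU] U FU; split=> // Uy;
      apply: nU; exists U.
    by move=> H; split=> [|[U FU Uy]]; [case: (H U0 FU0)|case: (H U FU)].
  apply/seteqP; split=> // x _.
  pose B U := (L `\` U) `&` j @^-1` [set x].
  have BF : ProperFilter (filter_from F B).
    apply: filter_from_proper => [|U FU].
      apply: filter_from_filter; first by exists U0.
      move=> U V FU FV; have [UV|VU] := Ftot _ _ FU FV.
        exists V => // y [[Ly nV] yx]; split=> //; split=> //; split=> //.
        by move=> /UV.
      exists U => // y [[Ly nV] yx]; split=> //; split=> //; split=> //.
      by move=> /VU.
    have [_ Ucov] := FP U FU;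
      have [y [Ly nU] yx] : (j @` (L `\` U)) x by rewrite Ucov.
    by exists y.
  have [|y [_ yB]] := cY BF; first by exists U0.
  have BcU U : F U -> B U y.
    move=> FU; have [Ucl _] := FP U FU.
    have : closed (B U) by apply: closedI => //; exact: closed_fiber.
    by apply=> W Wy; apply: yB => //; exists U.
  exists y; last by case: (BcU U0 FU0).
  split; first by case: (BcU U0 FU0) => [[]].
  by move=> [U FU Uy]; case: (BcU U FU) => [[]].
exists (L `\` U); last by move=> y [].
split=> // K' K'cov K'sub; apply: contrapT => K'ne.
apply: (Umax (~` K')).
  split=> [y Uy /K'sub[_]//|H]; apply: K'ne; apply/seteqP; split=> // y [Ly nU].
  by apply: contrapT => /H.
rewrite /= (_ : L `\` ~` K' = K')//; apply/seteqP; split=> y.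
  by move=> [_ /contrapT].
by move=> K'y; split; [case: (K'sub _ K'y)|move=> /(_ K'y)].
Qed.

End Covers.

Section SubspaceTopology.
Variables (T : topologicalType) (K : set T).

Lemma val_continuous : continuous (val : set_type K -> T).
Proof. exact: initial_continuous. Qed.

Lemma sub_hausdorff : hausdorff_space T -> hausdorff_space (set_type K).
Proof.
move=> hT p q pq; apply: val_inj; apply: hT => A B Ap Bq.
have [||w [? ?]] := pq (val @^-1` A) (val @^-1` B); last by exists (val w).
- exact: val_continuous.
- exact: val_continuous.
Qed.

Lemma sub_compact : compact K -> compact [set: set_type K].
Proof.
move=> cK F FF _.
have FK : F (val @^-1` K) by apply: (filterS _ filterT) => y _;
  exact: set_mem (valP y).
have [x [Kx xF]] := cK (val @ F) _ FK.
exists (SigSub (mem_set Kx)); split=> // A B FA [O [[V oV VO] /= Ox OB]].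
have [||y [[z Az zy] Vy]] := xF (val @` A) V.
- by apply: (@filterS _ F _ A _ _ FA) => y Ay; exists y.
- by move: Ox; rewrite -VO => Vx; apply: open_nbhs_nbhs.
exists z; split=> //; apply: OB; rewrite -VO /=.
by rewrite -zy in Vy.
Qed.

End SubspaceTopology.

(** * Uniqueness of positive maps into an irreducible cover *)

Section ComplexContinuity.
Variables (R : realType) (Z : topologicalType).

Lemma continuous_Re (f : Z -> R[i]^o) :
  continuous f -> continuous (fun z => complex.Re (f z)).
Proof.
move=> fc z; apply/cvgrPdist_lt => e e0; have eC0 : 0 < e%:C by rewrite ltcR.
have /cvgrPdist_lt/(_ _ eC0) := fc z; apply: filterS => w.
rewrite -Re_norm ltcR; apply: le_lt_trans.
by rewrite -(raddfB (@complex.Re R)) norm_Re.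
Qed.

Lemma continuous_real_complex (f : Z -> R) :
  continuous f -> continuous (fun z => (f z)%:C : R[i]^o).
Proof.
move=> fc z; apply/cvgrPdist_lt => _ /complex_gt0E[e e0 ->].
have /cvgrPdist_lt/(_ _ e0) := fc z; apply: filterS => w.
by rewrite -rmorphB norm_real ltcR.
Qed.

End ComplexContinuity.

Section Urysohn.
Variables (R : realType) (X : topologicalType) (cX : compact [set: X]).
Hypothesis hX : hausdorff_space X.

Lemma urysohn_cfun (B : set X) (x : X) : closed B -> ~ B x ->
  exists h : X -> R, [/\ continuous (fun y => (h y)%:C : R[i]^o),
    forall y, 0 <= h y, h x = 0 & forall y, B y -> h y = 1].
Proof.
move=> Bcl nBx.
have x_cl : closed [set x].
  by apply: accessible_closed_set1; exact: hausdorff_accessible.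
have xB : [set x] `&` B = set0 by apply/disjoints_subset => _ ->.
have /normal_separatorP/(_ _ _ x_cl Bcl xB) := compact_normal hX cX.
move=> /(_ R)/(@uniform_separatorP _ R)[h [hc h01 h0 h1]].
exists h; split.
- exact: continuous_real_complex.
- by move=> y; have /h01 : range h (h y) by []; rewrite /= in_itv/= => /andP[].
- by have := h0 (h x); apply; exists x.
- by move=> y By; have := h1 (h y); apply; exists y.
Qed.

End Urysohn.

Section StatesOnFunctions.
Variables (R : realType) (Z : topologicalType) (cZ : compact [set: Z]).
Variable phi : cfun R cZ -> R[i].
Hypothesis phi_state : state phi.

Lemma state_pointwise_ge0 (f : cfun R cZ) : (forall z, 0 <= f z) -> 0 <= phi f.
Proof.
move=> f0.
have [||N NE] := @psdmx_pointwise R Z cZ 1 (const_mx f).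
- move=> i j; rewrite !mxE; apply: cfP => z.
  change ((f z)^*%C = f z); have /complex_ge0P[] := f0 z.
  by case: (f z) => a b /= ->; rewrite oppr0.
- move=> z v; rewrite !big_ord1 mxE mulrAC mulr_ge0//.
  by rewrite mulrC mulcJ_ge0.
have := NE 0 0; rewrite mxE big_ord1 => ->.
exact: (state_adjM_ge0 phi_state (N 0 0)).
Qed.

Variables (X : topologicalType) (cX : compact [set: X]) (hX : hausdorff_space
  X).
Variables (j : Z -> X) (cj : continuous j) (x : X).
Hypothesis phi_eval : forall f : cfun R cX, phi (pullback cX cZ cj f) = f x.

(** The state [phi] lives on the fibre of [x]: as [Re f <= c - e] holds only on
    a compact set off the fibre, [Re f] is at least [c - e - N h o j] for some
    large [N] and some [h >= 0] on [X] that is [0] at [x] and [1] on the image of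
    that set. *)
Lemma state_fiber_ge (f : cfun R cZ) (c : R) :
  (forall z, j z = x -> c <= complex.Re (f z)) -> c <= complex.Re (phi f).
Proof.
move=> fc; apply/ler_addgt0Pr => e e0; rewrite -lerBlDr.
pose B := j @` [set z | complex.Re (f z) <= c - e].
have Bcl : closed B.
  apply: compact_closed => //; apply: continuous_compact.
    exact: continuous_subspaceT.
  apply: (subclosed_compact _ cZ) => //.
  apply: (@closed_comp _ _ (fun z => complex.Re (f z)) [set r | r <= c - e]).
    by move=> z _; apply: continuous_Re; exact: cf_cts.
  exact: closed_le.
have nBx : ~ B x.
  by move=> [z /= fz jz]; have := fc z jz; lra.
have [h [hc h0 hx h1]] := urysohn_cfun R cX hX Bcl nBx.
(* [N] bounds the excess of [c - e] over [Re f]. *)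
pose N := `|c - e| + rnorm f.
have N0 : 0 <= N by rewrite addr_ge0// rnorm_ge0.
pose F : cring (cfun R cZ) := f.
pose H : cring (cfun R cZ) := pullback cX cZ cj (mkcf cX hc).
pose k : cring (cfun R cZ) := F + adj F - (2%:R * (c - e))%:C *: (1 : cring
  (cfun R cZ)) + (2%:R * N)%:C *: H.
have k0 z : 0 <= (k : cfun R cZ) z.
  have -> : (k : cfun R cZ) z = f z + (f z)^*%C - (2%:R * (c - e))%:C * 1
    + (2%:R * N)%:C * (h (j z))%:C by [].
  have : complex.Re (f z) <= c - e -> h (j z) = 1 by move=> fz; apply: h1;
    exists z.
  have : - complex.Re (f z) <= rnorm f.
    rewrite (le_trans (ler_norm _))// normrN (le_trans (norm_Re _))//.
    by rewrite -lecR -rnormE Re_norm; exact: norm_cf_le.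
  have := ler_norm (c - e); have := h0 (j z); rewrite /N.
  case: (f z) => a b /= hz0 ce fN h1z; apply/complex_ge0P => /=; split;
    first ring.
  have [/h1z->|ca] := leP a (c - e); first by lra.
  by have := mulr_ge0 N0 hz0; rewrite /N; lra.
have := state_pointwise_ge0 k0.
rewrite /k (stateD phi_state) (stateB phi_state) (stateD phi_state).
rewrite !(stateZ phi_state) (state_adj phi_state) (state1 phi_state) /H
  phi_eval.
rewrite (_ : cf_eval (mkcf cX hc) x = 0); last by change ((h x)%:C = 0);
  rewrite hx.
by rewrite /F; case: (phi f) => a b /complex_ge0P[_ /=]; lra.
Qed.

End StatesOnFunctions.

Section Irreducible.
Variables (R : realType) (X Z G : topologicalType).
Variables (cX : compact [set: X]) (cZ : compact [set: Z]) (cG : compact [set: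
  G]).
Variable hX : hausdorff_space X.
Variables (j : Z -> X) (cj : continuous j) (p : G -> X) (cp : continuous p).
Hypothesis sp : p @` [set: G] = [set: X].
Hypothesis irr : forall F, covering_closed_set p F -> F = [set: G].
Variable K : set Z.
Hypothesis Kcov : j @` K = [set: X].
Hypothesis Kmin : forall L, covering_closed_set j L -> K `<=` L.

Definition positive_over (rho : cfun R cZ -> cfun R cG) :=
  (forall g, state (fun f => rho f g)) /\
  forall f : cfun R cX, rho (pullback cX cZ cj f) = pullback cX cG cp f.

(** If [Re (rho2 f) < c < d < Re (rho1 f)] on a nonempty open set [V], then by
    irreducibility [V] contains the preimage of a nonempty open set [W]. Over
    each point of [W], the real part of [f] takes values [<= c] and values
    [>= d], so [K] is contained in two closed sets with image [X] that are
    disjoint over [W]. *)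
Let Re_le (rho1 rho2 : cfun R cZ -> cfun R cG) (f : cfun R cZ) g :
  positive_over rho1 -> positive_over rho2 ->
  complex.Re (rho1 f g) <= complex.Re (rho2 f g).
Proof.
move=> [st1 over1] [st2 over2]; rewrite leNgt; apply/negP => lt21.
pose a := complex.Re (rho2 f g); pose b := complex.Re (rho1 f g).
pose c := (2%:R * a + b) / 3%:R; pose d := (a + 2%:R * b) / 3%:R.
have ab : a < b by [].
have [ac cd db] : [/\ a < c, c < d & d < b] by rewrite /c /d; split; lra.
pose V := [set g | complex.Re (rho2 f g) < c] `&` [set g | d < complex.Re (rho1
  f g)].
have Vo : open V.
  apply: openI.
    apply: (@open_comp _ _ (fun g => complex.Re (rho2 f g)) [set r | r < c]).
      by move=> w _; apply: continuous_Re; exact: cf_cts.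
    exact: open_lt.
  apply: (@open_comp _ _ (fun g => complex.Re (rho1 f g)) [set r | d < r]).
    by move=> w _; apply: continuous_Re; exact: cf_cts.
  exact: open_gt.
pose W := ~` (p @` ~` V).
have Wo : open W.
  apply: closed_openC; apply: compact_closed => //; apply: continuous_compact.
    exact: continuous_subspaceT.
  by apply: (subclosed_compact _ cG) => //; exact: open_closedC.
have [x Wx] : W !=set0.
  apply/set0P/negP => /eqP W0; have nV : covering_closed_set p (~` V).
    by split; [exact: open_closedC|rewrite -[LHS]setCK -/W W0 setC0].
  have : [set: G] g by []; by rewrite -(irr nV); apply.
have WV x' g' : W x' -> p g' = x' -> V g'.
  by move=> Wx' pg'; apply: contrapT => nV; apply: Wx'; exists g'.
have ev (rho : cfun R cZ -> cfun R cG) g' :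
    (forall f : cfun R cX, rho (pullback cX cZ cj f) = pullback cX cG cp f) ->
    forall f : cfun R cX, rho (pullback cX cZ cj f) g' = f (p g').
  by move=> H f'; rewrite H.
have low x' : W x' -> exists2 z, j z = x' & complex.Re (f z) <= c.
  move=> Wx'; have [g' _ pg'] : (p @` setT) x' by rewrite sp.
  apply: contrapT => H; have [gc _] := WV _ _ Wx' pg'.
  have := state_fiber_ge (st2 g') hX (ev _ g' over2) (f := f) (c := c).
  rewrite pg' leNgt gc => /(_ _)/negP; apply => // z jz.
  by rewrite leNgt; apply/negP => fc; apply: H; exists z => //; exact: ltW.
have high x' : W x' -> exists2 z, j z = x' & d <= complex.Re (f z).
  move=> Wx'; have [g' _ pg'] : (p @` setT) x' by rewrite sp.
  apply: contrapT => H; have [_ gd] := WV _ _ Wx' pg'.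
  have := state_fiber_ge (st1 g') hX (ev _ g' over1) (f := - f) (c := - d).
  rewrite pg' (stateN (st1 g')) raddfN/= lerN2 leNgt gd => /(_ _)/negP;
    apply => // z jz.
  rewrite [(- f) z](_ : _ = - f z)// raddfN/= lerN2 leNgt; apply/negP => fc.
  by apply: H; exists z => //; exact: ltW.
have Ycl : closed (~` (j @^-1` W)).
  by apply: open_closedC; apply: open_comp => // z _; exact: cj.
have fRe : continuous (fun z => complex.Re (f z)).
  by apply: continuous_Re; exact: cf_cts.
have cov (L : set Z) : closed L -> (forall x', W x' -> exists2 z, j z = x' & L
  z) ->
    covering_closed_set j (~` (j @^-1` W) `|` L).
  move=> Lcl LW; split; first exact: closedU.
  apply/seteqP; split=> // x' _; have [Wx'|nW] := pselect (W x').
    by have [z jz Lz] := LW _ Wx'; exists z => //; right.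
  have [z Kz jz] : (j @` K) x' by rewrite Kcov.
  by exists z => //; left; rewrite /= jz.
have lcl : closed [set z | complex.Re (f z) <= c].
  apply: (@closed_comp _ _ (fun z => complex.Re (f z)) [set r | r <= c]).
    by move=> z _; exact: fRe.
  exact: closed_le.
have gcl : closed [set z | d <= complex.Re (f z)].
  apply: (@closed_comp _ _ (fun z => complex.Re (f z)) [set r | d <= r]).
    by move=> z _; exact: fRe.
  exact: closed_ge.
have K1 := Kmin (cov _ lcl low); have K2 := Kmin (cov _ gcl high).
have [z Kz jz] : (j @` K) x by rewrite Kcov.
have [|/= zc] := K1 z Kz; first by rewrite /= jz => /(_ Wx).
have [|/= zd] := K2 z Kz; first by rewrite /= jz => /(_ Wx).
by lra.
Qed.

(** By symmetry it suffices to compare the real parts of [rho1 f] and [rho2 f],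
    and by complex linearity this also settles the imaginary parts. *)
Theorem positive_over_unique (rho1 rho2 : cfun R cZ -> cfun R cG) :
  positive_over rho1 -> positive_over rho2 -> rho1 = rho2.
Proof.
move=> pos1 pos2; apply/funext => f; apply: cfP => g.
have Re_eq f' : complex.Re (rho1 f' g) = complex.Re (rho2 f' g).
  by apply/eqP; rewrite eq_le !Re_le.
apply: complex_ext => //; have := Re_eq ('i%C *: f).
rewrite (stateZ (pos1.1 g)) (stateZ (pos2.1 g)).
by case: (rho1 f g) (rho2 f g) => [a b] [c d] /=; lra.
Qed.

End Irreducible.

(** * Completely positive maps and states *)

Section UcpStates.
Variables (R : realType).
Implicit Types A B : cstarAlgType R.

Lemma psdmx_adjM A (a : cring A) : psdmx (const_mx (adj a * a : A) : 'M_1).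
Proof. by exists (const_mx a) => i j; rewrite big_ord1 !mxE. Qed.

Lemma ucp_pos A B (E : set A) (T : set B) (f : A -> B) (a : cring A) :
  ucp E T f -> E (adj a * a) -> exists b : cring B, f (adj a * a) = adj b * b.
Proof.
move=> [_ _ _ fpos] Ea.
have [|N NE] := fpos 1%N (const_mx (adj a * a : A)) _ (psdmx_adjM a).
  by move=> i j; rewrite mxE.
by exists (N 0 0); have := NE 0 0; rewrite !mxE big_ord1.
Qed.

Lemma state_ucp A B (f : A -> B) (phi : B -> R[i]) :
  ucp [set: A] [set: B] f -> state phi -> state (phi \o f).
Proof.
move=> fucp phi_st; have [_ flin f1 _] := fucp; split=> [z x y||a] /=.
- by rewrite flin// (stateD phi_st) (stateZ phi_st).
- by rewrite f1; have [] := phi_st.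
- have [b ->] := ucp_pos (a := a) fucp I; exact: state_adjM_ge0.
Qed.

Lemma eval_state (Z : topologicalType) (cZ : compact [set: Z]) z :
  state (fun f : cfun R cZ => f z).
Proof.
split=> // a; rewrite [X in 0 <= X](_ : _ = (a : cfun R cZ) z * ((a : cfun R
  cZ) z)^*%C).
  exact: mulcJ_ge0.
by rewrite mulrC.
Qed.

(** The sum is the value of [phi] at the sum of the [b_k^* b_k], where [M = N^* N]
    and [b = N v]. *)
Lemma state_psd A (phi : A -> R[i]) n (M : 'M[A]_n) (v : 'I_n -> R[i]) :
  state phi -> psdmx M -> 0 <= \sum_i \sum_j (v i)^*%C * phi (M i j) * v j.
Proof.
move=> st [N NE]; pose b k : cring A := \sum_j v j *: (N k j : cring A).
rewrite (_ : \sum_i _ = \sum_k phi (adj (b k) * b k)).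
  by apply: sumr_ge0 => k _; exact: state_adjM_ge0.
rewrite (eq_bigr (fun i => \sum_k \sum_j phi (((v i)^*%C *: adj (N k i : cring
  A)) *
    (v j *: (N k j : cring A))))); last first.
  move=> i _; rewrite exchange_big; apply: eq_bigr => j _ /=.
  rewrite NE (state_sum st) big_distrr big_distrl; apply: eq_bigr => k _ /=.
  by rewrite -cscalerAl -cscalerAr !(stateZ st) mulrA mulrAC.
rewrite exchange_big; apply: eq_bigr => k _ /=.
rewrite (_ : adj (b k) = \sum_i (v i)^*%C *: adj (N k i : cring A)); last first.
  rewrite /b (big_morph (@adj R A) (@adjD R A) (@adj0 R A)).
  by apply: eq_bigr => i _; rewrite adjZ.
rewrite mulr_suml (state_sum st); apply: eq_bigr => i _.
by rewrite mulr_sumr (state_sum st).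
Qed.

Lemma psdmx_herm A n (M : 'M[A]_n) i j : psdmx M -> star (M j i) = M i j.
Proof.
move=> [N NE]; rewrite !NE.
rewrite (big_morph (star : A -> A) (@starD R A) (@adj0 R A)).
by apply: eq_bigr => k _; rewrite starM starK.
Qed.

(** Positivity of a matrix over [C(Z)] can be tested at the points of [Z], where
    [state_psd] applies. *)
Lemma ucp_of_states A (Z : topologicalType) (cZ : compact [set: Z])
    (g : A -> cfun R cZ) (F : set A) :
  (forall z, state (fun a => g a z)) -> ucp F [set: cfun R cZ] g.
Proof.
move=> st; split=> //.
- by move=> a x y _ _; apply: cfP => z; have [->] := st z.
- by apply: cfP => z; have [_ ->] := st z.
- move=> n M _ Mpsd; apply: psdmx_pointwise => [i j|z v].
    apply: cfP => z; rewrite !mxE -(psdmx_herm i j Mpsd).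
    exact: esym (state_adj (st z) (M j i)).
  rewrite (eq_bigr (fun i => \sum_j (v i)^*%C * g (M i j) z * v j)).
    exact: state_psd (st z) Mpsd.
  by move=> i _; apply: eq_bigr => j _; rewrite mxE.
Qed.

Lemma hom_psdmx A B (f : A -> B) n (M : 'M[A]_n) :
  cstar_hom f -> psdmx M -> psdmx (map_mx f M).
Proof.
move=> [flin _ fM fstar] [N NE]; exists (map_mx f N) => i j; rewrite mxE NE.
have f0 : f 0 = 0.
  by have := flin (-1) 0 0; rewrite scaler0 addr0 scaleN1r addNr.
have fD : {morph f : x y / x + y}.
  by move=> x y; have := flin 1 x y; rewrite !scale1r.
rewrite (big_morph f fD f0); apply: eq_bigr => k _.
by rewrite !mxE fM fstar.
Qed.

Lemma hom_ucp A B (f : A -> B) : cstar_hom f -> ucp [set: A] [set: B] f.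
Proof.
move=> fhom; have [flin f1 _ _] := fhom; split=> //.
- by move=> a x y _ _; exact: flin.
- by move=> n M _; exact: hom_psdmx.
Qed.

End UcpStates.

(** * The embedding induced by a surjection is completely isometric *)

Section HilbertModuleNorm.
Variables (R : realType) (Z : topologicalType) (cZ : compact [set: Z]).
Variable n : nat.
Implicit Types x : 'cV[cfun R cZ]_n.

Lemma hmnorm_sumE x z :
  (\sum_i star (x i 0) ** x i 0 : cfun R cZ) z = \sum_i (x i 0 z)^*%C * x i 0 z.
Proof. exact: cf_sumE. Qed.

Lemma hmnorm_leP x (b : R) : 0 <= b ->
  hmnorm x <= b <-> forall z, \sum_i (x i 0 z)^*%C * x i 0 z <= (b ^+ 2)%:C.
Proof.
move=> b0; set F := \sum_i star (x i 0) ** x i 0.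
have -> : hmnorm x <= b <-> rnorm F <= b ^+ 2.
  rewrite /hmnorm -/F -/(rnorm F) -{1}(ger0_norm b0) -sqrtr_sqr.
  by rewrite ler_sqrt// sqr_ge0.
have FE z : F z = \sum_i (x i 0 z)^*%C * x i 0 z := hmnorm_sumE x z.
have F0 z : 0 <= F z.
  by rewrite FE sumr_ge0// => i _; rewrite mulrC mulcJ_ge0.
split=> [Fb z|Fb].
  rewrite -FE -[leLHS]ger0_norm// (le_trans (norm_cf_le _ _))//.
  by rewrite rnormE lecR.
rewrite -lecR -rnormE; apply: cfun_norm_le => [|z];
  first by rewrite lecR sqr_ge0.
by have := Fb z; rewrite -FE -{1}(ger0_norm (F0 z)).
Qed.

Lemma hmnorm_ge0 x : 0 <= hmnorm x. Proof. exact: sqrtr_ge0. Qed.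

Lemma mxactE (M : 'M[cfun R cZ]_n) x i z :
  mxact M x i 0 z = \sum_j M i j z * x j 0 z.
Proof. by rewrite mxE; exact: cf_sumE. Qed.

End HilbertModuleNorm.

Section PullbackIsometry.
Variables (R : realType) (X G : topologicalType).
Variables (cX : compact [set: X]) (cG : compact [set: G]).
Variables (p : G -> X) (cp : continuous p) (sp : p @` [set: G] = [set: X]).
Local Notation tau := (pullback cX cG cp : cfun R cX -> cfun R cG).

Lemma pullback_hom : cstar_hom tau.
Proof. by split => [a f g||f g|f]; exact: cfP. Qed.

(** The supremum defining the norm may be computed with constant vectors, as
    the action is pointwise. *)
Lemma mxcnorm_pullback n (M : 'M[cfun R cX]_n) :
  mxcnorm (map_mx tau M) = mxcnorm M.
Proof.
have hm_tau (x : 'cV[cfun R cX]_n) : hmnorm (map_mx tau x) = hmnorm x.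
  apply/eqP; rewrite eq_le; apply/andP; split; apply/hmnorm_leP;
    rewrite ?hmnorm_ge0//.
    move=> g; have /(hmnorm_leP _ (hmnorm_ge0 _))/(_ (p g)) := lexx (hmnorm x).
    by under [X in _ -> X <= _]eq_bigr do rewrite mxE.
  move=> z; have [g _ gz] : (p @` setT) z by rewrite sp.
  have /(hmnorm_leP _ (hmnorm_ge0 _))/(_ g) := lexx (hmnorm (map_mx tau x)).
  by under eq_bigr do rewrite mxE; rewrite -gz.
rewrite /mxcnorm; set S2 := [set _ | _ in _]; set S1 := [set _ | _ in _].
have S12 : S1 `<=` S2.
  move=> _ [x /= x1 <-]; exists (map_mx tau x).
    by have := x1; rewrite -hm_tau.
  rewrite -hm_tau; congr hmnorm; apply/colP => i; apply: cfP => g.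
  rewrite [in RHS]mxE; apply: etrans (mxactE _ _ _ _) _.
  apply: etrans _ (esym (mxactE M x i (p g))); apply: eq_bigr => k _.
  by rewrite !mxE.
have hm0 : hmnorm (0 : 'cV[cfun R cX]_n) <= 1.
  apply/hmnorm_leP => // z; rewrite big1 ?lecR ?expr1n// => i _.
  by rewrite mxE mulr0.
have S1n : S1 !=set0 by exists (hmnorm (mxact M 0)), 0.
have S2n : S2 !=set0 by have [s ss] := S1n; exists s; exact: S12.
have ub : ubound S2 = ubound S1.
  apply/seteqP; split=> b bub; first by move=> s /S12; exact: bub.
  have b0 : 0 <= b.
    by rewrite (le_trans (hmnorm_ge0 (mxact M 0)))//; apply: bub; exists 0.
  move=> _ [w /= w1 <-]; apply/hmnorm_leP => // g.
  pose x : 'cV[cfun R cX]_n := \col_i cf_cst cX (w i 0 g).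
  have x1 : hmnorm x <= 1.
    apply/hmnorm_leP => // z; have /(hmnorm_leP _ ler01)/(_ g) := w1.
    by congr (_ <= _); apply: eq_bigr => i _; rewrite mxE.
  have /bub/(hmnorm_leP _ b0)/(_ (p g)) : S1 (hmnorm (mxact M x)) by exists x.
  congr (_ <= _); apply: eq_bigr => i _.
  suff E : mxact M x i 0 (p g) = mxact (map_mx tau M) w i 0 g.
    exact: (congr1 (fun t : R[i] => t^*%C * t) E).
  apply: etrans (mxactE _ _ _ _) _; apply: etrans _ (esym (mxactE _ _ _ _)).
  by apply: eq_bigr => k _; rewrite !mxE.
rewrite /sup /supremum /supremums ub.
by move/set0P/negPf: S1n => ->; move/set0P/negPf: S2n => ->.
Qed.

Lemma pullback_isometry :
  unital_complete_isometry [set: cfun R cX] [set: cfun R cG] tau.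
Proof.
have [lin one _ _] := pullback_hom; split=> //; first by move=> a x y _ _;
  exact: lin.
by move=> n M _; exact: mxcnorm_pullback.
Qed.

End PullbackIsometry.

(** * The irreducible cover of a compact space *)

Lemma complex_hausdorff (R : realType) : hausdorff_space R[i]^o.
Proof. exact: norm_hausdorff. Qed.

Lemma complex_lim_unique (R : realType) (T : Type) (F : set_system T)
    (FF : ProperFilter F) (f : T -> R[i]^o) (l l' : R[i]^o) :
  f @ F --> l -> f @ F --> l' -> l = l'.
Proof.
exact: (@cvg_unique _ (@complex_hausdorff R) (f @ F) (fmap_proper_filter f FF)
  l l').
Qed.

Lemma complex_lim_ge0 (R : realType) (T : Type) (F : set_system T)
    (FF : ProperFilter F) (f : T -> R[i]^o) (l : R[i]^o) :
  (forall x, 0 <= (f x : R[i])) -> f @ F --> l -> 0 <= (l : R[i]).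
Proof.
move=> f0 fl; suff /eqP : `|l - `|l : R[i]| : R[i]^o| = 0.
  by rewrite normr_eq0 subr_eq0 => /eqP->.
apply/eqP; rewrite -[_ == 0]negbK; apply/negP;
  rewrite normr_eq0 -normr_gt0 => d0.
have d20 : 0 < `|l - `|l : R[i]| : R[i]^o| / 2%:R by rewrite divr_gt0.
have /cvgrPdist_lt/(_ _ d20) lf := fl; have [x /= lx] := filter_ex lf.
suff /le_lt_trans/(_ (ltrD lx lx)) : `|l - `|l : R[i]| : R[i]^o|
    <= `|l - f x| + `|l - f x| by rewrite -splitr ltxx.
have -> : l - `|l : R[i]| = (l - f x) + (`|f x : R[i]| - `|l : R[i]|) :> R[i]^o.
  by rewrite (ger0_norm (f0 x)) addrA subrK.
by rewrite (le_trans (ler_normD _ _))// lerD// distrC ler_dist_dist.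
Qed.

Lemma fst_cts (U V : topologicalType) : continuous (@fst U V).
Proof. by move=> w A; exact: cvg_fst. Qed.
Lemma snd_cts (U V : topologicalType) : continuous (@snd U V).
Proof. by move=> w A; exact: cvg_snd. Qed.

Lemma complex_disc_compact (R : realType) (b : R) :
  exists2 C : set R[i]^o, compact C & forall z : R[i], complex.Re `|z| <= b ->
    C z.
Proof.
pose f (w : R * R) : R[i]^o := w.1 +i* w.2.
exists (f @` (`[- b, b] `*` `[- b, b])).
  apply: continuous_compact; last by apply: compact_setX;
    exact: segment_compact.
  apply: continuous_subspaceT => w.
  have -> : f = fun w : R * R => (w.1)%:C + 'i%C * (w.2)%:C :> R[i]^o.
    by apply/funext => -[u v]; apply: complex_ext => /=; rewrite /f/=; ring.
  apply: cvgD; first by apply: continuous_real_complex; exact: fst_cts.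
  apply: cvgM; first exact: cvg_cst.
  by apply: continuous_real_complex; exact: snd_cts.
move=> z zb; exists (complex.Re z, complex.Im z); last by case: z {zb}.
have := le_trans (norm_Re z) zb; have := le_trans (norm_Im z) zb.
by split; rewrite /= in_itv/= -ler_norml.
Qed.

Lemma compact_regular_space (T : topologicalType) :
  hausdorff_space T -> compact [set: T] -> regular_space T.
Proof. by move=> hT cT x; apply: (compact_regular hT cT); exact: filterT. Qed.

Section Gleason.
Variables (R : realType) (X : topologicalType) (cX : compact [set: X]).
Hypothesis hX : hausdorff_space X.
Variable p0 : beta X -> X.
Hypotheses (cp0 : continuous p0) (p0_lim : forall u, ultra u --> p0 u).

Lemma beta_lift (T : topologicalType) (j : T -> X) (L : set T) :
  hausdorff_space T -> compact [set: T] -> continuous j ->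
  covering_closed_set j L ->
  exists q : beta X -> T, [/\ continuous q, forall u, L (q u),
    forall u, j (q u) = p0 u & exists2 s : X -> T, forall x, j (s x) = x
    & forall u, s @ ultra u --> q u].
Proof.
move=> hT cT cj [Lcl Lcov].
have /boolp.choice[s sP] x : exists t, L t /\ j t = x.
  have [t Lt jt] : (j @` L) x by rewrite Lcov.
  by exists t.
have [||q [qc qL qlim]] := @beta_extension X T L s (compact_regular_space hT
  cT).
- exact: subclosed_compact Lcl cT _.
- by move=> x; case: (sP x).
exists q; split=> // [u|]; last by exists s => // x; case: (sP x).
have uF := ultra_filter u.
apply: (cvg_unique hX (F := ultra u)) => //.
have js : j \o s = id by apply/funext => x; case: (sP x).
  by have := cvg_comp _ _ (qlim u) (cj (q u)); rewrite js.
exact: p0_lim.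
Qed.

Variable K : set (beta X).
Hypothesis Kmin : minimal_covering_closed_set p0 K.

Definition cover_map (g : set_type K) : X := p0 (val g).
Local Notation G := (set_type K).
Local Notation p := cover_map.

Lemma cover_compact_space : compact [set: G].
Proof.
apply: sub_compact; have [[Kcl _] _] := Kmin.
exact: subclosed_compact Kcl (@beta_compact X) _.
Qed.

Lemma cover_hausdorff : hausdorff_space G.
Proof. exact: sub_hausdorff (@beta_hausdorff X). Qed.

Lemma cover_map_continuous : continuous p.
Proof. by move=> g; apply: continuous_comp;
  [exact: val_continuous|exact: cp0]. Qed.

Lemma cover_map_surj : p @` [set: G] = [set: X].
Proof.
apply/seteqP; split=> // x _; have [[_ Kcov] _] := Kmin.
have [u Ku ux] : (p0 @` K) x by rewrite Kcov.
by exists (SigSub (mem_set Ku)).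
Qed.

Lemma cover_map_irreducible F : covering_closed_set p F -> F = [set: G].
Proof.
move=> [Fcl Fcov]; apply/seteqP; split=> // g _; have [_ Kmin'] := Kmin.
have valF : covering_closed_set p0 (val @` F).
  split.
    apply: compact_closed; first exact: beta_hausdorff.
    apply: continuous_compact;
      last exact: subclosed_compact Fcl cover_compact_space _.
    by apply: continuous_subspaceT; exact: val_continuous.
  apply/seteqP; split=> // x _; have [g' Fg' g'x] : (p @` F) x by rewrite Fcov.
  by exists (val g') => //; exists g'.
have E : val @` F = K.
  by apply: Kmin' => // _ [g' _ <-]; exact: set_mem (valP g').
have : (val @` F) (val g) by rewrite E; exact: set_mem (valP g).
by move=> [g' Fg' /val_inj <-].
Qed.

Local Notation cG := cover_compact_space.
Local Notation CG := (cfun R cG).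
Local Notation tau := (pullback cX cG cover_map_continuous : cfun R cX -> CG).

Lemma cover_positive_unique (Z : topologicalType) (cZ : compact [set: Z])
    (j : Z -> X) (cj : continuous j) (L : set Z) (rho1 rho2 : cfun R cZ -> CG) :
  j @` L = [set: X] -> (forall L', covering_closed_set j L' -> L `<=` L') ->
  positive_over cX cj cover_map_continuous rho1 ->
  positive_over cX cj cover_map_continuous rho2 -> rho1 = rho2.
Proof.
move=> Lcov Lmin pos1 pos2.
exact: (positive_over_unique hX cover_map_surj cover_map_irreducible Lcov Lmin
  pos1 pos2).
Qed.

(** [G] is the only closed subset of [G] with image [X]. *)
Lemma cover_rigid (rho : CG -> CG) :
  positive_over cX cover_map_continuous cover_map_continuous rho -> rho = id.
Proof.
move=> pos; apply: (cover_positive_unique (L := [set: G]) cover_map_surj _ pos).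
  by move=> L' /cover_map_irreducible ->.
by split=> // g; exact: eval_state.
Qed.

(** Extend the states [f(s x)] for a section [s] of [p], let [x] run to the
    points of [G] along ultrafilters, and use that by rigidity the extension of
    [s] restricts to the identity of [G]. *)
Theorem cover_injective : injective_opsys [set: CG].
Proof.
move=> A E F Eop _ EF f fucp.
have [|q [qc _ pq [s ps slim]]] := beta_lift cover_hausdorff cG
  cover_map_continuous (L := [set: G]).
  by split; [exact: closedT|exact: cover_map_surj].
have [_ flin f1 _] := fucp.
have /boolp.choice[psi psiP] x : exists psi : A -> R[i]^o,
    state psi /\ forall a, E a -> psi a = f a (s x).
  have [|||psi st psiE] := @state_extension R A E (fun a => f a (s x)) Eop.
  - by move=> z a b Ea Eb; rewrite flin.
  - by rewrite f1.
  - move=> a Ea; have [b ->] := ucp_pos fucp Ea.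
    exact: (state_adjM_ge0 (eval_state R cG (s x)) b).
  by exists psi.
have /boolp.choice[h hP] a : exists h : beta X -> R[i]^o, continuous h /\
    forall u, psi^~ a @ ultra u --> h u.
  have [C cC CP] := @complex_disc_compact R (@rnorm R (cring A) a).
  have [|h [hc _ hlim]] := @beta_extension X R[i]^o C (psi^~ a) uniform_regular
    cC.
    by move=> x; apply: CP; have [st _] := psiP x; exact: (state_norm_le st).
  by exists h.
have hst u : state (h^~ u).
  have uF := ultra_filter u.
  have hE a l : psi^~ a @ ultra u --> (l : R[i]^o) -> h a u = l.
    have ah : psi^~ a @ ultra u --> h a u by case: (hP a).
    have U := @complex_lim_unique R X (ultra u) uF (psi^~ a) (h a u) l.
    exact: U ah.
  split=> [z a b||a].
  - apply: hE; rewrite (_ : psi^~ _ = fun x => z * psi x a + psi x b : R[i]^o).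
      apply: cvgD; last by case: (hP b).
      by apply: cvgM; [exact: cvg_cst|case: (hP a)].
    by apply/funext => x; have [st _] := psiP x;
      rewrite (stateD st) (stateZ st).
  - apply: hE; rewrite (_ : psi^~ _ = fun=> 1 : R[i]^o); first exact: cvg_cst.
    by apply/funext => x; have [[_ -> _] _] := psiP x.
  - have [_ /(_ u)] := hP (adj a * a); apply: complex_lim_ge0 => x.
    by have [st _] := psiP x; exact: (state_adjM_ge0 st).
pose g a : CG := mkcf cG (fun w : G => continuous_comp (@val_continuous _ K w)
  ((hP a).1 (val w))).
have gst w : state (fun a => g a w) by exact: hst.
exists g; first exact: ucp_of_states.
move=> a Ea; apply: cfP => w.
have uF := ultra_filter (val w).
have qv_cts : continuous (q \o val : G -> G).
  by move=> w'; apply: continuous_comp; [exact: val_continuous|exact: qc].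
have fq : f a w = f a (q (val w)).
  have pos : positive_over cX cover_map_continuous cover_map_continuous
      (pullback cG cG qv_cts : CG -> CG).
    split=> [w'|k]; first exact: (eval_state R cG (q (val w'))).
    by apply: cfP => w'; exact: (congr1 (fun x => k x) (pq (val w'))).
  exact: esym (congr1 (fun rho : CG -> CG => rho (f a) w) (cover_rigid pos)).
apply: etrans _ (esym fq).
have ah : psi^~ a @ ultra (val w) --> h a (val w) by case: (hP a).
apply: (@complex_lim_unique R X (ultra (val w)) uF (psi^~ a) _ _ ah).
have -> : psi^~ a = cf_eval (f a : CG) \o s.
  by apply/funext => x; case: (psiP x) => _; exact.
exact: (cvg_comp s (f a : CG) (slim (val w)) (@cf_cts _ _ _ (f a : CG) (q (val
  w)))).
Qed.

End Gleason.

(** * The injective envelope is the algebra of the irreducible cover *)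

Section Schwarz.
Variable R : realType.
Implicit Types A B : cstarAlgType R.

Lemma hmnorm1 A (x : 'cV[A]_1) : hmnorm x = rnorm (x 0 0 : cring A).
Proof.
rewrite /hmnorm big_ord1 -[complex.Re _]/(rnorm (adj (x 0 0 : cring A) * x 0
  0)).
by rewrite rnorm_adjM sqrtr_sqr ger0_norm// rnorm_ge0.
Qed.

Lemma mxcnorm1 A (a : cring A) : mxcnorm (const_mx a : 'M[A]_1) = rnorm a.
Proof.
rewrite /mxcnorm; set S := [set _ | _ in _].
have S1 : S (rnorm a).
  exists (const_mx (1 : cring A)).
    by rewrite /mkset hmnorm1 mxE; exact: rnorm1_le1.
  rewrite hmnorm1 !mxE big_ord1 !mxE; congr rnorm; exact: (mulr1 a).
have Sub : ubound S (rnorm a).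
  move=> _ [x /= x1 <-]; rewrite hmnorm1 !mxE big_ord1 !mxE.
  apply: (le_trans (rnormM a (x 0 0))); rewrite -[leRHS]mulr1.
  by rewrite ler_wpM2l ?rnorm_ge0// -hmnorm1.
apply/eqP; rewrite eq_le; apply/andP; split.
  by apply: ge_sup => //; exists (rnorm a).
by apply: ub_le_sup => //; exists (rnorm a).
Qed.

(** The matrix with rows [a^* a, a^*] and [a, 1] is positive, and a factorization
    of its image shows that [f(a^* a) - f(a)^* f(a)] is a sum of elements
    [b^* b]. *)
Lemma kadison_schwarz A B (f : A -> B) (phi : B -> R[i]) (a : cring A) :
  ucp [set: A] [set: B] f -> state phi ->
  phi (adj (f a : cring B) * f a) <= phi (f (adj a * a)).
Proof.
move=> fucp st; have [_ _ f1 fpos] := fucp.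
pose row (i : 'I_2) : cring A := if i == 0 then a else 1.
pose N : 'M[A]_2 := \matrix_(k, i) if k == 0 then row i else 0.
pose M : 'M[A]_2 := \matrix_(i, j) (adj (row i) * row j).
have Mpsd : psdmx M.
  exists N => i j; rewrite !mxE big_ord_recl big_ord1 !mxE /=.
  by rewrite [X in _ + X](mulr0 (adj (0 : cring A)))// addr0.
have [|N' N'E] := fpos 2%N M _ Mpsd; first by move=> i j.
pose n (i k : 'I_2) : cring B := N' k i.
have nE i j : \sum_k adj (n i k) * n j k = f (adj (row i) * row j).
  by have := N'E i j; rewrite !mxE.
pose c : cring B := f a.
have n10 : \sum_k adj (n 1 k) * n 0 k = c by rewrite nE/= adj1 mul1r.
have n01 : \sum_k adj (n 0 k) * n 1 k = adj c.
  rewrite -n10 (big_morph (@adj R B) (@adjD R B) (@adj0 R B)).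
  by apply: eq_bigr => k _; rewrite adjM adjK.
have n11 : \sum_k adj (n 1 k) * n 1 k = 1.
  by rewrite nE/= adj1 mul1r; exact: f1.
pose b k := n 0 k - n 1 k * c.
have bE : \sum_k adj (b k) * b k = f (adj a * a) - adj c * c.
  have -> : f (adj a * a) = \sum_k adj (n 0 k) * n 0 k by rewrite nE.
  rewrite (eq_bigr (fun k => adj (n 0 k) * n 0 k - adj (n 0 k) * n 1 k * c -
    (adj c * (adj (n 1 k) * n 0 k) - adj c * (adj (n 1 k) * n 1 k) * c)));
      last first.
    by move=> k _; rewrite /b adjB adjM mulrBl !mulrBr !mulrA.
  rewrite !sumrB -!mulr_suml -!mulr_sumr n01 n10 n11 mulr1 subrr subr0.
  by [].
rewrite -subr_ge0 -(stateB st) -bE (state_sum st).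
by apply: sumr_ge0 => k _; exact: state_adjM_ge0.
Qed.

End Schwarz.

Section Envelope.
Variables (R : realType) (X : topologicalType) (cX : compact [set: X]).
Hypothesis hX : hausdorff_space X.
Variable p0 : beta X -> X.
Hypotheses (cp0 : continuous p0) (p0_lim : forall u, ultra u --> p0 u).
Variable K : set (beta X).
Hypothesis Kmin : minimal_covering_closed_set p0 K.

Local Notation G := (set_type K).
Local Notation cG := (cover_compact_space Kmin).
Local Notation cp := (cover_map_continuous cp0 (K := K)).
Local Notation CG := (cfun R cG).
Local Notation tau := (pullback cX cG cp : cfun R cX -> CG).

Variables (I : cstarAlgType R) (iota : cfun R cX -> I).
Hypothesis envI : injective_envelope iota.

Lemma tau_inj : injective tau.
Proof.
move=> f g fg; apply: cfP => x;
  have [w _ <-] : (cover_map p0 (K := K) @` setT) x.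
  by rewrite (cover_map_surj Kmin).
exact: (congr1 (fun h : CG => h w) fg).
Qed.

(** Composed with the evaluations, the isometry given by the universal property
    becomes a family of unital contractive functionals, which are states. *)
Lemma envelope_to_cover : exists u : I -> CG,
  [/\ forall w, state (fun a => u a w), injective u
    & forall f, u (iota f) = tau f].
Proof.
have [_ _ univ] := envI.
have opT : operator_system [set: CG] by split.
have [u [_ ulin u1 uiso] uE] := univ CG [set: CG] opT
  (@cover_injective R X cX hX p0 cp0 p0_lim K Kmin) tau
  (pullback_isometry R cX cG cp (cover_map_surj Kmin)).
have un (a : cring I) : rnorm (u a : cring CG) = rnorm a.
  rewrite -!mxcnorm1 -uiso; last by [].
  by congr mxcnorm; apply/matrixP => i j; rewrite !mxE.
exists u; split=> // [w|a b ab].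
  apply: state_of_contraction => [z x y||x].
  - by rewrite ulin.
  - by rewrite u1.
  - by rewrite -un -lecR -rnormE Re_norm; exact: norm_cf_le.
apply: subr0_eq; apply: rnorm_eq0; rewrite -(un (a - b)).
have -> : u (a - b) = u a - u b.
  by have := ulin (-1) b a Logic.I Logic.I;
    rewrite !scaleN1r addrC [_ + u a]addrC.
by rewrite ab subrr rnorm0.
Qed.

(** Positive matrices over the copy of [C(X)] in [C(G)] have square roots over
    [C(X)], so [iota] is completely positive on this copy and extends. *)
Lemma cover_to_envelope : exists2 v : CG -> I,
  ucp [set: CG] [set: I] v & forall f, v (tau f) = iota f.
Proof.
have [[iota_hom iota_inj] injI _] := envI.
have [tlin t1 tM tstar] := pullback_hom R cX cG cp.
pose E : set CG := range tau.
have Eop : operator_system E.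
  split; first by exists cunit.
    by move=> z _ _ [f _ <-] [g _ <-]; exists (z *: f + g) => //; exact: tlin.
  by move=> _ [f _ <-]; exists (star f) => //; exact: tstar.
have tT : operator_system [set: CG] by split.
have /boolp.choice[l lP] g : exists f, E g -> tau f = g.
  have [[f _ fg]|nE] := pselect (E g); first by exists f.
  by exists 0.
have lK f : l (tau f) = f by apply: tau_inj; apply: lP; exists f.
have [||v vucp vE] := injI CG E [set: CG] Eop tT _ (iota \o l).
- by [].
- have [ilin i1 _ _] := iota_hom; split=> //=.
  + move=> z _ _ [f _ <-] [g _ <-] /=.
    by rewrite -tlin !lK ilin.
  + by rewrite -t1 lK.
  + move=> n M EM Mpsd; pose M0 := map_mx l M.
    have ME i j : M i j = tau (M0 i j) by rewrite mxE lP.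
    have M0psd : psdmx M0.
      apply: psdmx_pointwise => [i j|x w].
        by apply: tau_inj; rewrite tstar -!ME; exact: psdmx_herm.
      have [g _ gx] : (cover_map p0 (K := K) @` setT) x.
        by rewrite (cover_map_surj Kmin).
      have := state_psd w (eval_state R cG g) Mpsd.
      congr (_ <= _); apply: eq_bigr => i _; apply: eq_bigr => k _.
      by rewrite ME -gx.
    have := hom_psdmx iota_hom M0psd; rewrite /M0.
    by rewrite -map_mx_comp.
exists v => // f; rewrite vE/= ?lK//.
by exists f.
Qed.

(** The maps of the two previous lemmas are inverse to each other by rigidity,
    and a positive bijection with positive inverse between these algebras is
    multiplicative because both satisfy the Schwarz inequality. *)
Theorem envelope_iso : exists (u : I -> CG) (v : CG -> I),
  [/\ cstar_hom v, cancel v u, injective u, forall w, state (fun a => u a w)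
    & (forall f, u (iota f) = tau f) /\ forall f, v (tau f) = iota f].
Proof.
have [u [ust uinj ui]] := envelope_to_cover.
have [v vucp vi] := cover_to_envelope.
have vK : cancel v u.
  move=> f; have pos : positive_over cX cp cp (u \o v).
    split=> [w|k]; first exact: (state_ucp vucp (ust w)).
    by rewrite /= vi ui.
  exact: (congr1 (fun rho : CG -> CG => rho f) (cover_rigid hX pos)).
exists u, v; split=> //; have [_ vlin v1 _] := vucp.
have vD : {morph v : f g / f + g}.
  by move=> f g; have := vlin 1 f g Logic.I Logic.I; rewrite !scale1r.
have v0 : v 0 = 0 by apply: (addrI (v 0)); rewrite -vD !addr0.
have vZ (z : R[i]) f : v (z *: f) = z *: v f.
  by have := vlin z f 0 Logic.I Logic.I; rewrite v0 !addr0.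
have vstar : {morph v : f / star f}.
  move=> f; apply: uinj; rewrite vK; apply: cfP => w.
  have := state_adj (ust w) (v f); rewrite vK => E.
  exact: esym E.
have diag (f : cring CG) : v (adj f * f) = adj (v f : cring I) * v f.
  apply: uinj; rewrite vK; apply: cfP => w; apply/eqP; rewrite eq_le.
  have := kadison_schwarz f vucp (ust w); rewrite vK => ->; rewrite andbT.
  have := state_sqr_le (ust w) (v f); rewrite vK.
  by [].
(* A sesquilinear form that vanishes on the diagonal is zero. *)
pose D (g f : cring CG) : cring I := v (adj g * f) - adj (v g : cring I) * v f.
have DD g g' f f' : D (g + g') (f + f') = D g f + D g f' + (D g' f + D g' f').
  rewrite /D adjD !mulrDl !mulrDr !vD adjD !mulrDl !mulrDr.
  by rewrite opprD addrACA; congr (_ + _); rewrite opprD addrACA.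
have Di g f :
    D ('i%C *: g) f = - ('i%C *: D g f) /\ D g ('i%C *: f) = 'i%C *: D g f.
  have vN k : v (- k) = - v k by rewrite -scaleN1r vZ scaleN1r.
  rewrite /D !adjZi vZ adjZi !mulNr -!cscalerAl -!cscalerAr vN !vZ -cscalerAr.
  by split; rewrite scalerBr// opprB opprK addrC.
have D0 f : D f f = 0 by rewrite /D diag subrr.
have Danti g f : D g f + D f g = 0.
  by have := D0 (g + f); rewrite DD !D0 add0r addr0.
have D00 g f : D g f = 0.
  have := Danti ('i%C *: g) f; rewrite (Di g f).1 (Di f g).2 addrC -scalerBr.
  move=> /(congr1 (fun x => 'i%C *: x)); rewrite scaler_ii scaler0 opprB.
  move=> /subr0_eq E; have := Danti g f;
    rewrite -E => /(congr1 (fun x => (2%:R^-1 : R)%:C *: x)).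
  by rewrite scaler_half scaler0.
split=> //; first by move=> z f g; exact: vlin.
move=> g f; have := D00 (adj g) f; rewrite /D adjK => /subr0_eq ->.
by rewrite [v (adj g)]vstar [adj _]starK.
Qed.

End Envelope.

(** * Disjoint ideals and closed covers *)

Section HullKernel.
Variables (R : realType) (X Y : topologicalType).
Variables (cX : compact [set: X]) (cY : compact [set: Y]).
Hypotheses (hX : hausdorff_space X) (hY : hausdorff_space Y).
Variables (j : Y -> X) (cj : continuous j) (sj : j @` [set: Y] = [set: X]).
Local Notation CX := (cfun R cX).
Local Notation CY := (cfun R cY).
Local Notation incl := (pullback cX cY cj : CX -> CY).

Definition hull (J : set CY) : set Y := [set y | forall f, J f -> f y = 0].
Definition kernel (K : set Y) : set CY := [set f | forall y, K y -> f y = 0].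

Lemma zeros_closed (f : CY) : closed [set y | f y = 0].
Proof.
apply: (@closed_comp _ _ (f : Y -> R[i]^o) [set 0]).
  by move=> y _; exact: cf_cts.
exact: accessible_closed_set1 (hausdorff_accessible (@complex_hausdorff R)) _.
Qed.

Lemma hull_closed J : closed (hull J).
Proof.
rewrite (_ : hull J = \bigcap_(f in J) [set y | f y = 0]).
  by apply: closed_bigI => f _; exact: zeros_closed.
by apply/seteqP; split=> y H f /H.
Qed.

Lemma norm_at_zero (f g : CY) y : g y = 0 -> `|f y : R[i]| <= `|f - g|.
Proof.
move=> gy; have := norm_cf_le (f - g) y.
change (`|f y - g y : R[i]| <= `|f - g| -> `|f y : R[i]| <= `|f - g|).
by rewrite gy subr0.
Qed.

Lemma kernel_ideal K : closed_ideal (kernel K).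
Proof.
split=> // [f fK y Ky|z f g fK gK y Ky|g f fK].
- apply/eqP/negPn/negP => fy0.
  have e0 : 0 < `|f y : R[i]| by rewrite normr_gt0.
  have [|g [gK /=]] := fK (ball f `|f y : R[i]|); first exact: nbhsx_ballx.
  rewrite -ball_normE/= => /(le_lt_trans (norm_at_zero f (gK y Ky))).
  by rewrite ltxx.
- change (z * cf_eval (f : CY) y + cf_eval (g : CY) y = 0).
  by rewrite (fK y Ky : cf_eval (f : CY) y = 0) (gK y Ky : cf_eval (g : CY) y =
    0) mulr0 addr0.
- split=> y Ky.
    change (cf_eval (g : CY) y * cf_eval (f : CY) y = 0).
    by rewrite (fK y Ky : cf_eval (f : CY) y = 0) mulr0.
  change (cf_eval (f : CY) y * cf_eval (g : CY) y = 0).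
  by rewrite (fK y Ky : cf_eval (f : CY) y = 0) mul0r.
Qed.

Lemma kernel_disjoint K : j @` K = [set: X] -> disjoint_ideal incl (kernel K).
Proof.
move=> Kcov; split; first exact: kernel_ideal.
apply/seteqP; split=> [_ [[f _ <-] fK]|_ ->]; last first.
  by split; [exists 0 => //; exact: cfP|].
apply: cfP => y; have [y' Ky' jy'] : (j @` K) (j y) by rewrite Kcov.
by have := fK y' Ky'; change (f (j y') = 0 -> f (j y) = 0); rewrite jy'.
Qed.

Lemma separate_point (K : set Y) y : closed K -> ~ K y ->
  exists2 f : CY, kernel K f & f y <> 0.
Proof.
move=> Kcl nKy; have [h [hc _ hy h1]] := urysohn_cfun R cY hY Kcl nKy.
have c1 : continuous (fun z => 1 - (h z)%:C : R[i]^o).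
  by move=> z; apply: cvgB; [exact: cvg_cst|exact: hc].
exists (mkcf cY c1) => [z Kz|].
  by rewrite [LHS](_ : _ = 1 - (h z)%:C)// h1// subrr.
by rewrite [X in X <> _](_ : _ = 1 - (h y)%:C)// hy subr0; apply/eqP/oner_neq0.
Qed.

Lemma hull_kernel K : closed K -> hull (kernel K) = K.
Proof.
move=> Kcl; apply/seteqP; split=> y; last by move=> Ky f; exact.
move=> H; apply: contrapT => /(separate_point Kcl)[f fK].
by apply; exact: H.
Qed.

Lemma continuous_pos (T : topologicalType) (h : T -> R) : continuous h ->
  continuous (fun y => Num.max (h y) 0).
Proof.
move=> hc y; rewrite (_ : (fun y => _) = fun y => (h y + `|h y|) / 2%:R).
  apply: cvgM; last exact: cvg_cst.
  by apply: cvgD; [exact: hc|apply: cvg_norm; exact: hc].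
apply/funext => z; have [h0|h0] := leP 0 (h z).
  by rewrite (ger0_norm h0) -mulr2n -[_ *+ 2]mulr_natr mulfK// pnatr_eq0.
by rewrite (ltr0_norm h0) subrr mul0r.
Qed.

(** If [x] is not in [j(hull J)], some [f] in [J] has no zero on the fibre of
    [x]; then [J] contains the pullback of a function that is nonzero at [x] and
    vanishes near [j] of the zeros of [f]. *)
Lemma hull_cover J : disjoint_ideal incl J -> covering_closed_set j (hull J).
Proof.
move=> [[Jcl J0 Jlin Jmul] Jdisj]; split; first exact: hull_closed.
have sq_mem (f : CY) : J f -> J (star f ** f) by move=> /(Jmul (star f))[].
apply/seteqP; split=> // x _; apply: contrapT => nx.
have [f Jf fx] : exists2 f : CY, J f & forall y, j y = x -> f y <> 0.
  apply: contrapT => H.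
  pose B (f : CY) := [set y | f y = 0] `&` j @^-1` [set x].
  have BF : ProperFilter (filter_from J B).
    apply: filter_from_proper => [|f Jf].
      apply: filter_from_filter; first by exists 0.
      move=> f g Jf Jg; exists (star f ** f + star g ** g).
        by have := Jlin 1 _ _ (sq_mem f Jf) (sq_mem g Jg); rewrite scale1r.
      move=> y [/= fg0 yx].
      have E : f y * (f y)^*%C + g y * (g y)^*%C = 0.
        by rewrite -[RHS]fg0 [RHS](_ : _ = (f y)^*%C * f y + (g y)^*%C * g
          y)//; congr (_ + _); exact: mulrC.
      have fy0 := mulcJ_ge0 (f y); have gy0 := mulcJ_ge0 (g y).
      move/eqP: E; rewrite paddr_eq0// !mulf_eq0 !conjc_eq0 !orbb.
      by move=> /andP[/eqP ? /eqP ?].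
    apply: contrapT => Bf0; apply: H; exists f => // y yx fy; apply: Bf0.
    by exists y.
  have [|y [_ yB]] := cY BF; first by exists 0.
  have By g : J g -> B g y.
    move=> Jg; have : closed (B g).
      by apply: closedI; [exact: zeros_closed|exact: closed_fiber].
    by apply=> W Wy; apply: yB => //; exists g.
  by apply: nx; exists y; [move=> g /By[]|case: (By 0 J0)].
pose Z := j @` [set y | f y = 0].
have Zcl : closed Z.
  apply: compact_closed => //; apply: continuous_compact.
    exact: continuous_subspaceT.
  by apply: (subclosed_compact _ cY) => //; exact: zeros_closed.
have nZx : ~ Z x by move=> [y /= fy /fx].
have [h [hc h0 hx h1]] := urysohn_cfun R cX hX Zcl nZx.
have hRc : continuous h by exact: (continuous_Re hc).
pose a (t : X) : R := Num.max (2%:R^-1 - h t) 0.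
have ac : continuous a.
  apply: continuous_pos => t; apply: cvgB; [exact: cvg_cst|exact: hRc].
pose F (y : Y) := complex.Re ((star f ** f : CY) y).
have FE y : (star f ** f : CY) y = (F y)%:C.
  have : 0 <= (star f ** f : CY) y.
    by rewrite [X in 0 <= X](_ : _ = f y * (f y)^*%C) ?mulcJ_ge0//;
      exact: mulrC.
  by move=> /ger0_real/RRe_real.
have F0 y : 0 <= F y.
  rewrite -lecR -FE [X in 0 <= X](_ : _ = f y * (f y)^*%C) ?mulcJ_ge0//.
  exact: mulrC.
have Feq0 y : F y = 0 -> f y = 0.
  move=> Fy0; have := FE y; rewrite Fy0.
  rewrite [X in X = _](_ : _ = (f y)^*%C * f y)// => /eqP.
  by rewrite mulf_eq0 conjc_eq0 orbb => /eqP.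
(* [w] has no zero, and equals [F] wherever [a o j] is not zero. *)
pose w y : R := F y + Num.max (h (j y) - 2%:R^-1) 0.
have w0 y : w y != 0.
  rewrite gt_eqF// /w; have [Fy0|Fy0] := eqVneq (F y) 0.
    rewrite Fy0 add0r h1; first by rewrite lt_max; apply/orP; left; lra.
    by exists y => //; exact: Feq0.
  by rewrite ltr_pwDl ?le_max ?lexx ?orbT// lt_neqAle eq_sym Fy0 F0.
have kc : continuous (fun y => (a (j y) / w y)%:C : R[i]^o).
  apply: continuous_real_complex => y; apply: cvgM.
    by apply: continuous_comp; [exact: cj|exact: ac].
  apply: cvgV => //; apply: cvgD; first by apply: continuous_Re; exact: cf_cts.
  apply: (@continuous_pos Y (fun y => h (j y) - 2%:R^-1)) => z.
  apply: cvgB; last exact: cvg_cst.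
  by apply: (@continuous_comp _ _ _ j h); [exact: cj|exact: hRc].
have Jk : J ((star f ** f) ** mkcf cY kc) by have [_] := Jmul (mkcf cY kc) _
  (sq_mem f Jf).
have aC : continuous (fun t => (a t)%:C : R[i]^o) by exact:
  continuous_real_complex.
have kE : incl (mkcf cX aC) = (star f ** f) ** mkcf cY kc.
  apply: cfP => y; change ((a (j y))%:C = (star f ** f : CY) y * (a (j y) / w
    y)%:C).
  rewrite FE -rmorphM; congr _%:C; have [hy|hy] := leP (h (j y)) 2%:R^-1.
    have wF : w y = F y by rewrite /w max_r ?addr0// subr_le0.
    by rewrite -wF mulrCA mulfV ?mulr1.
  have a0 : a (j y) = 0 by rewrite /a max_r// subr_le0 ltW.
  by rewrite a0 mul0r mulr0.
have : (range incl `&` J) (incl (mkcf cX aC)).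
  by split; [exists (mkcf cX aC)|rewrite kE].
rewrite Jdisj => /= k0; have [y _ yx] : (j @` setT) x by rewrite sj.
have : (a (j y))%:C = 0 by exact: (congr1 (fun g : CY => g y) k0).
move/complexI; rewrite yx /a hx subr0 max_l ?invr_ge0// => /eqP.
by rewrite invr_eq0 pnatr_eq0.
Qed.

Lemma maximal_ideal_hull J : maximal_disjoint_ideal incl J ->
  minimal_covering_closed_set j (hull J) /\ kernel (hull J) = J.
Proof.
move=> [Jdisj Jmax]; have Hcov := hull_cover Jdisj.
have Jk : J `<=` kernel (hull J) by move=> f Jf y; exact.
have kJ : kernel (hull J) = J.
  by apply: Jmax => //; apply: kernel_disjoint; case: Hcov.
split=> //; split=> // K [Kcl Kcov] KJ.
have -> : J = kernel K.
  apply/esym/Jmax; first exact: kernel_disjoint.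
  by move=> f Jf y /KJ; exact.
by rewrite hull_kernel.
Qed.

Lemma minimal_cover_kernel K : minimal_covering_closed_set j K ->
  maximal_disjoint_ideal incl (kernel K).
Proof.
move=> [[Kcl Kcov] Kmin]; split; first exact: kernel_disjoint.
move=> J Jdisj KJ; apply/seteqP; split=> // f Jf y Ky.
suff HK : hull J = K by move: Ky; rewrite -HK; exact.
apply: Kmin; first exact: hull_cover.
by move=> z Hz; rewrite -(hull_kernel Kcl) => g /KJ; exact: Hz.
Qed.

(** [hull] and [kernel] are inverse to each other on these families. *)
Lemma unique_ideal_cover :
  (exists! J, maximal_disjoint_ideal incl J) <->
  (exists! K, minimal_covering_closed_set j K).
Proof.
split=> [[J [Jmax Juniq]]|[K [Kmin Kuniq]]].
  exists (hull J); split; first by case: (maximal_ideal_hull Jmax).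
  move=> K Kmin; rewrite (Juniq _ (minimal_cover_kernel Kmin)) hull_kernel//.
  by case: Kmin => [[]].
exists (kernel K); split; first exact: minimal_cover_kernel.
move=> J Jmax; have [Hmin kJ] := maximal_ideal_hull Jmax.
by rewrite (Kuniq _ Hmin).
Qed.

End HullKernel.

(** * Pseudo-expectations *)

Section PseudoExpectations.
Variables (R : realType) (X Y : topologicalType).
Variables (cX : compact [set: X]) (cY : compact [set: Y]).
Hypotheses (hX : hausdorff_space X) (hY : hausdorff_space Y).
Variables (j : Y -> X) (cj : continuous j).
Variables (I : cstarAlgType R) (iota : cfun R cX -> I).
Local Notation CY := (cfun R cY).
Local Notation incl := (pullback cX cY cj : cfun R cX -> CY).

Lemma gleason_cover_exists : exists (p0 : beta X -> X) (K : set (beta X)),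
  [/\ continuous p0, forall u, ultra u --> p0 u & minimal_covering_closed_set
    p0 K].
Proof.
have [|p0 [cp0 _ p0_lim]] :=
  @beta_extension X X setT id (compact_regular_space hX cX) cX.
  by [].
have cov : covering_closed_set p0 setT.
  split; first exact: closedT.
  apply/seteqP; split=> // x _; exists (principal x) => //.
  have pF := ultra_filter (principal x).
  apply: (cvg_unique hX (F := ultra (principal x))); first exact: p0_lim.
  by move=> V Vx; apply/principal_filterP; exact: nbhs_singleton.
have [K Kmin _] := minimal_cover_exists hX (@beta_compact X) cp0 cov.
by exists p0, K.
Qed.

Section Lift.
Variables (p0 : beta X -> X) (K0 : set (beta X)).
Hypotheses (cp0 : continuous p0) (p0_lim : forall u, ultra u --> p0 u).
Hypothesis K0min : minimal_covering_closed_set p0 K0.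
Local Notation G := (set_type K0).
Local Notation cG := (cover_compact_space K0min).
Local Notation p := (cover_map p0 (K := K0)).
Local Notation cp := (cover_map_continuous cp0 (K := K0)).
Local Notation CG := (cfun R cG).

(** By minimality of [K], the lift of [p] to [K] is onto. *)
Lemma lift_to_minimal_cover K : minimal_covering_closed_set j K ->
  exists q : G -> Y, [/\ continuous q, forall w, j (q w) = p w & range q = K].
Proof.
move=> [Kcov Kmin].
have [q0 [q0c q0K jq0 _]] := beta_lift hX p0_lim hY cY cj Kcov.
have qc : continuous (q0 \o val : G -> Y).
  by move=> w; apply: continuous_comp; [exact: val_continuous|exact: q0c].
exists (q0 \o val); split=> //; first by move=> w; exact: jq0.
apply: Kmin; last by move=> _ [w _ <-]; exact: q0K.
split.
  apply: compact_closed => //; apply: continuous_compact; last exact: cG.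
  exact: continuous_subspaceT.
apply/seteqP; split=> // x _.
have [w _ wx] : (p @` setT) x by rewrite (cover_map_surj K0min).
by exists (q0 (val w)); [exists w|rewrite jq0].
Qed.

Variables (u : I -> CG) (v : CG -> I).
Hypotheses (vhom : cstar_hom v) (vK : cancel v u) (uinj : injective u).
Hypothesis ust : forall w, state (fun a => u a w).
Hypothesis ui : forall f, u (iota f) = pullback cX cG cp f.
Hypothesis vi : forall f, v (pullback cX cG cp f) = iota f.

Lemma lift_multiplicative (q : G -> Y) (qc : continuous q) :
  (forall w, j (q w) = p w) ->
  multiplicative_pseudo_expectation incl iota
    (v \o (pullback cY cG qc : CY -> CG)).
Proof.
move=> jq.
have hom : cstar_hom (v \o (pullback cY cG qc : CY -> CG)).
  have [vlin v1 vM vstar] := vhom.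
  have [qlin q1 qM qstar] := pullback_hom R cY cG qc.
  split=> [z f g||f g|f] /=.
  - by rewrite qlin vlin.
  - by rewrite q1 v1.
  - by rewrite qM vM.
  - by rewrite qstar vstar.
split=> //; split; first exact: hom_ucp.
move=> f; rewrite -vi /=; congr v; apply: cfP => w.
exact: (congr1 (fun x => f x) (jq w)).
Qed.

Lemma minimal_cover_pseudo_expectation K : minimal_covering_closed_set j K ->
  exists2 Phi : CY -> I, multiplicative_pseudo_expectation incl iota Phi &
    exists (q : G -> Y) (qc : continuous q),
      range q = K /\ Phi = v \o (pullback cY cG qc : CY -> CG).
Proof.
move=> Kmin; have [q [qc jq qK]] := lift_to_minimal_cover Kmin.
exists (v \o (pullback cY cG qc : CY -> CG)); first exact: lift_multiplicative.
by exists q, qc.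
Qed.

Lemma pseudo_expectation_positive (Phi : CY -> I) :
  pseudo_expectation incl iota Phi ->
  positive_over cX cj cp (u \o Phi : CY -> CG).
Proof.
move=> [Phi_ucp Phi_i]; split=> [w|f]; first exact: (state_ucp Phi_ucp (ust w)).
by rewrite /= Phi_i ui.
Qed.

End Lift.
End PseudoExpectations.

Theorem corollary3p21 (R : realType) (X Y : topologicalType)
  (cX : compact [set: X]) (cY : compact [set: Y])
  (hX : hausdorff_space X) (hY : hausdorff_space Y)
  (j : Y -> X) (cj : continuous j) (sj : j @` [set: Y] = [set: X])
  (I : cstarAlgType R) (iota : cfun R cX -> I)
  (envI : injective_envelope iota) :
  [<-> exists! Phi : cfun R cY -> I,
         pseudo_expectation (pullback cX cY cj) iota Phi;
       exists! Phi : cfun R cY -> I,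
         multiplicative_pseudo_expectation (pullback cX cY cj) iota Phi;
       exists! J : set (cfun R cY),
         maximal_disjoint_ideal (pullback cX cY cj) J;
       exists! K : set Y, minimal_covering_closed_set j K].
Proof.
have [p0 [K0 [cp0 p0_lim K0min]]] := gleason_cover_exists cX hX.
have [u [v [vhom vK uinj ust [ui vi]]]] := envelope_iso hX cp0 p0_lim K0min envI.
have mult_pe := minimal_cover_pseudo_expectation cY hX hY cj p0_lim vhom vi.
have [K1 K1min _] : exists2 K, minimal_covering_closed_set j K & K `<=` setT.
  by apply: minimal_cover_exists => //; split=> //; exact: closedT.
have ideal_cover := unique_ideal_cover R cX cY hX hY cj sj.
tfae.
- move=> [Phi [pePhi Puniq]]; have [Psi Psi_mult _] := mult_pe K1 K1min.
  exists Psi; split=> // Phi' [pePhi' _].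
  by rewrite -(Puniq Psi Psi_mult.1); exact: Puniq.
- move=> [Phi [_ Puniq]]; apply/ideal_cover; exists K1; split=> // K Kmin.
  have [Phi1 /Puniq <- [q1 [q1c [<- E1]]]] := mult_pe K1 K1min.
  have [Phi2 /Puniq PE [q [qc [<- E2]]]] := mult_pe K Kmin.
  suff -> : q1 = q by [].
  apply/funext => w; apply: contrapT => q1q.
  have q1cl : closed [set q1 w].
    by apply: accessible_closed_set1; exact: hausdorff_accessible.
  have nq : ~ [set q1 w] (q w) by move=> /= E; apply: q1q.
  have [f f0] := separate_point R cY hY q1cl nq; apply.
  rewrite -(f0 (q1 w))//.
  have := congr1 (fun P => u (P f)) (etrans (esym PE) E1).
  rewrite E2 /= !vK => E.
  exact: (congr1 (fun g : cfun R (cover_compact_space K0min) => g w) E).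
- by move/ideal_cover.
- move=> [K [Kmin Kuniq]].
  have [Phi [pePhi _] _] := mult_pe K Kmin.
  exists Phi; split=> // Psi pePsi; apply/funext => f; apply: uinj.
  have Kleast L : covering_closed_set j L -> K `<=` L.
    move=> Lcov; have [K2 K2min K2L] := minimal_cover_exists hX cY cj Lcov.
    by rewrite (Kuniq _ K2min).
  have E := cover_positive_unique hX Kmin.1.2 Kleast
    (pseudo_expectation_positive ust ui pePhi)
    (pseudo_expectation_positive ust ui pePsi).
  exact: (congr1 (fun rho => rho f) E).
Qed.
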